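(* Let $N,n,m,\tau_{\mathrm h}$ be positive integers, $\boldsymbol{A}_i\in\mathbb{R}^{n\times n}$, $\boldsymbol{B}_i\in\mathbb{R}^{n\times m}$ for $i\in\{1,\dots,N\}$, and $x_1^{\mathsf d},\dots,x_N^{\mathsf d}\in\mathbb{R}^n$. Suppose that for every $i$ the reachability Gramian $\boldsymbol{G}_{i,\tau_{\mathrm h}}:=\sum_{k=0}^{\tau_{\mathrm h}-1}\boldsymbol{A}_i^k\boldsymbol{B}_i\boldsymbol{B}_i^\top(\boldsymbol{A}_i^\top)^k$ is invertible, that for all $i,j$ there exists $\bar{\boldsymbol u}_{ij}\in\mathbb{R}^m$ such that $\boldsymbol{A}_ix_j^{\mathsf d}+\boldsymbol{B}_i\bar{\boldsymbol u}_{ij}=x_j^{\mathsf d}$, and that $\boldsymbol{A}_i$ is invertible for every $i$. For $\varepsilon>0$ let (S$_\varepsilon$) be the closed-loop system on $\mathbb{R}^{nN}\times(\mathbb{R}_{>0}^N/{\sim})$ defined in the context, and let $(x^{\mathsf e}(\varepsilon),\beta^{\mathsf e}(\varepsilon))$ denote an equilibrium of (S$_\varepsilon$) as a function of $\varepsilon$. Assume that for some $\varepsilon'>0$, $(x^{\mathsf e}(\varepsilon'),\beta^{\mathsf e}(\varepsilon'))\in\mathbb{R}^{nN}\times(\mathbb{R}_{>0}^N/{\sim})$ is an isolated equilibrium of (S$_{\varepsilon'}$). Then the following hold: (i) For sufficiently large $\varepsilon>0$, $(x^{\mathsf e}(\varepsilon),\beta^{\mathsf e}(\varepsilon))$ is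 a locally asymptotically stable equilibrium of (S$_\varepsilon$). (ii) Assume further that $x_i^{\mathsf d}\ne x_j^{\mathsf d}$ for all $(i,j)$ with $i\neq j$, and that $(x^{\mathsf e}(\cdot),\beta^{\mathsf e}(\cdot))\in\mathrm{Exp}(\sigma)$ for some permutation $\sigma$ of $\{1,\dots,N\}$. Then, for sufficiently small $\varepsilon>0$, $(x^{\mathsf e}(\varepsilon),\beta^{\mathsf e}(\varepsilon))$ is a locally asymptotically stable equilibrium of (S$_\varepsilon$).
   Context: Notation: $[x_1;\cdots;x_N]$ is the stacked column vector; $\mathbf{1}_N$ is the $N$-vector of ones; $\oslash$ is element-wise division; for $\alpha\in\mathbb{R}^N$, $\operatorname{diag}(\alpha)$ is the diagonal matrix with diagonal entries $\alpha_1,\dots,\alpha_N$; $\|v\|_G:=(v^\top Gv)^{1/2}$ for positive semidefinite $G$. On $\mathbb{R}_{>0}^N$, $\beta\sim\beta'$ iff $\beta=r\beta'$ for some $r>0$; $\mathbb{R}_{>0}^N/{\sim}$ is the corresponding quotient (projective cone). Define $$\bar{\boldsymbol A}_i:=\boldsymbol{A}_i-\boldsymbol{B}_i\boldsymbol{B}_i^\top(\boldsymbol{A}_i^\top)^{\tau_{\mathrm h}-1}\boldsymbol{G}_{i,\tau_{\mathrm h}}^{-1}\boldsymbol{A}_i^{\tau_{\mathrm h}},\qquad \mathcal{G}_i:=(\boldsymbol{A}_i^{\tau_{\mathrm h}})^\top\boldsymbol{G}_{i,\tau_{\mathrm h}}^{-1}\boldsymbol{A}_i^{\tau_{\mathrm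 h}}.$$ For $\varepsilon>0$, $x=[x_1;\cdots;x_N]\in\mathbb{R}^{nN}$ and $\beta\in\mathbb{R}_{>0}^N$ define $$\boldsymbol{K}(x)=(\boldsymbol{K}_{ij}(x))\in\mathbb{R}_{>0}^{N\times N},\quad \boldsymbol{K}_{ij}(x):=\exp\bigl(-\|x_i-x_j^{\mathsf d}\|_{\mathcal{G}_i}^2/\varepsilon\bigr),$$ $$f(x,\beta):=\mathbf{1}_N/N\oslash\bigl[\boldsymbol{K}(x)^\top(\mathbf{1}_N/N\oslash[\boldsymbol{K}(x)\beta])\bigr],\qquad \widetilde P(x,\beta):=\operatorname{diag}\bigl(\mathbf{1}_N/N\oslash[\boldsymbol{K}(x)\beta]\bigr)\boldsymbol{K}(x)\,\operatorname{diag}(\beta),$$ and $x_i^{\rm tmp}(P):=N\sum_{j=1}^NP_{ij}x_j^{\mathsf d}$ for $P\in\mathbb{R}_{\ge0}^{N\times N}$. The closed-loop system (S$_\varepsilon$) (generalized Sinkhorn MPC with one Sinkhorn iteration per time step) is, for $k\in\mathbb{Z}_{\ge0}$, $$\boldsymbol{x}_i[k+1]=\bar{\boldsymbol A}_i\boldsymbol{x}_i[k]+(I-\bar{\boldsymbol A}_i)\,x_i^{\rm tmp}\bigl(\widetilde P(\boldsymbol{x}[k],\beta[k])\bigr),\ i\in\{1,\dots,N\},\qquad \beta[k+1]=f(\boldsymbol{x}[k+1],\beta[k]),$$ where $\beta[\cdot]$ is regarded as a trajectory in $\mathbb{R}_{>0}^N/{\sim}$ (this is well defined since $f(x,r\beta)=rf(x,\beta)$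 and $\widetilde P(x,r\beta)=\widetilde P(x,\beta)$ for $r>0$). Equilibria, isolatedness and local asymptotic stability are understood in $\mathbb{R}^{nN}\times(\mathbb{R}_{>0}^N/{\sim})$. For $x\in\mathbb{R}^{nN}$, $P^*(x)$ (depending on $\varepsilon$) is the unique minimizer of $\sum_{i,j}C_{ij}P_{ij}+\varepsilon\sum_{i,j}P_{ij}(\log P_{ij}-1)$ over $\{P\in\mathbb{R}_{\ge0}^{N\times N}:P\mathbf{1}_N=P^\top\mathbf{1}_N=\mathbf{1}_N/N\}$ with $C_{ij}=\|x_i-x_j^{\mathsf d}\|_{\mathcal{G}_i}^2$ (convention $0\log 0=0$). For a permutation $\sigma$ of $\{1,\dots,N\}$, let $x_\sigma^{\mathsf d}:=[x_{\sigma(1)}^{\mathsf d};\cdots;x_{\sigma(N)}^{\mathsf d}]$ and let $P^\sigma$ be the matrix with $P^\sigma_{ij}=1/N$ if $j=\sigma(i)$ and $P^\sigma_{ij}=0$ otherwise. $\mathrm{Exp}(\sigma)$ is the set of all families $\varepsilon\mapsto(x^{\mathsf e}(\varepsilon),\beta^{\mathsf e}(\varepsilon))$ of equilibria of (S$_\varepsilon$) such that $x^{\mathsf e}(\varepsilon)$ and $P^*(x^{\mathsf e}(\varepsilon))$ converge exponentially to $x_\sigma^{\mathsf d}$ and $P^\sigma$, respectively, as $\varepsilon\searrow0$ (i.e. the errors are $O(e^{-b/\varepsilon})$ as $\varepsilon\searrow 0$ for some $b>0$). *)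

(* Defs.v *)
From HB Require Import structures.
From mathcomp Require Import all_boot all_order all_algebra all_fingroup.
From mathcomp Require Import all_classical all_reals all_analysis.
From mathcomp Require Import generic_quotient.

Set Implicit Arguments.
Unset Strict Implicit.
Unset Printing Implicit Defensive.

Import Order.TTheory GRing.Theory Num.Theory.
Import numFieldNormedType.Exports.

Local Open Scope classical_set_scope.
Local Open Scope quotient_scope.
Local Open Scope ring_scope.

Section Dynamics.
Variable T : topologicalType.
Implicit Types (F : T -> T) (e : T).

Definition equilibrium F e : Prop := F e = e.

Definition isolated_equilibrium F e : Prop :=
  equilibrium F e /\ \forall z \near e, equilibrium F z -> z = e.

Definition lyapunov_stable F e : Prop :=
  forall U : set T, nbhs e U -> \forall z \near e, forall k, U (iter k F z).

Definition locally_attractive F e : Prop :=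
  \forall z \near e, iter k F z @[k --> \oo] --> e.

Definition locally_asymptotically_stable F e : Prop :=
  [/\ equilibrium F e, lyapunov_stable F e & locally_attractive F e].

End Dynamics.

Section ProjectiveCone.
Variables (R : realType) (N : nat).

Definition pos_cone : set 'cV[R]_N := [set b | forall i, 0 < b i 0].

(* [pos_cone] coerced to a type carries the subspace topology. *)
Definition ray_rel : rel pos_cone :=
  fun b c => `[< exists2 r : R, 0 < r & \val b = r *: \val c >].

Lemma ray_rel_equiv : equiv_class_of ray_rel.
Proof.
split.
- by move=> b; apply/asboolP; exists 1; rewrite ?scale1r ?ltr01.
- move=> b c; apply/asboolP/asboolP => -[r r0 ->]; exists r^-1;
    by rewrite ?invr_gt0// scalerA mulVf ?scale1r ?gt_eqF.
- move=> c b d /asboolP[r r0 bc] /asboolP[s s0 cd]; apply/asboolP.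
  by exists (r * s); rewrite ?mulr_gt0// bc cd scalerA.
Qed.

Canonical ray_equiv : equiv_rel pos_cone := EquivRelPack ray_rel_equiv.

Definition projective_cone := quotient_topology {eq_quot ray_equiv}.

HB.instance Definition _ := Topological.on projective_cone.
HB.instance Definition _ := Quotient.on projective_cone.

End ProjectiveCone.

(* A state (x, [beta]): column i of x is x_i, so that 'M_(n, N) stands for
   R^(nN), the stacked vector being read blockwise. *)
Notation state R n N := ('M[R]_(n, N) * projective_cone R N)%type.

Section SinkhornMPC.
Variables (R : realType) (N n m tau : nat).
Variables (A : 'I_N -> 'M[R]_n) (B : 'I_N -> 'M[R]_(n, m)).
Variable xd : 'I_N -> 'cV[R]_n.

Definition reach_gramian (i : 'I_N) : 'M[R]_n :=
  \sum_(k < tau) A i ^+ k *m B i *m (B i)^T *m (A i)^T ^+ k.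

Definition Abar (i : 'I_N) : 'M[R]_n :=
  A i - B i *m (B i)^T *m (A i)^T ^+ tau.-1 *m invmx (reach_gramian i)
        *m A i ^+ tau.

Definition calG (i : 'I_N) : 'M[R]_n :=
  (A i ^+ tau)^T *m invmx (reach_gramian i) *m A i ^+ tau.

Definition wnorm (G : 'M[R]_n) (v : 'cV[R]_n) : R :=
  Num.sqrt ((v^T *m G *m v) 0 0).

Definition ediv (u v : 'cV[R]_N) : 'cV[R]_N := \col_i (u i 0 / v i 0).

Definition uniform_marginal : 'cV[R]_N := const_mx N%:R^-1.

Definition cost (x : 'M[R]_(n, N)) : 'M[R]_N :=
  \matrix_(i, j) wnorm (calG i) (col i x - xd j) ^+ 2.

Definition xtmp (i : 'I_N) (P : 'M[R]_N) : 'cV[R]_n :=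
  N%:R *: \sum_j P i j *: xd j.

Definition coupling : set 'M[R]_N :=
  [set P : 'M[R]_N | [/\ forall i j, 0 <= P i j,
               P *m const_mx 1 = uniform_marginal
             & P^T *m const_mx 1 = uniform_marginal]].

(* [ln 0 = 0] realizes the convention 0 log 0 = 0. *)
Definition entropic_cost (eps : R) (x : 'M[R]_(n, N)) (P : 'M[R]_N) : R :=
  \sum_i \sum_j cost x i j * P i j
  + eps * \sum_i \sum_j P i j * (ln (P i j) - 1).

Definition is_entropic_plan (eps : R) (x : 'M[R]_(n, N)) : set 'M[R]_N :=
  [set P : 'M[R]_N | coupling P /\
     forall Q, coupling Q -> entropic_cost eps x P <= entropic_cost eps x Q].

(* The minimizer exists and is unique when 0 < N and 0 < eps. *)
Definition entropic_plan (eps : R) (x : 'M[R]_(n, N)) : 'M[R]_N :=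
  xget 0 (is_entropic_plan eps x).

Section FixedEps.
Variable eps : R.

Definition gibbs (x : 'M[R]_(n, N)) : 'M[R]_N :=
  \matrix_(i, j) expR (- cost x i j / eps).

Definition scaling (x : 'M[R]_(n, N)) (b : 'cV[R]_N) : 'cV[R]_N :=
  ediv uniform_marginal (gibbs x *m b).

Definition sinkhorn (x : 'M[R]_(n, N)) (b : 'cV[R]_N) : 'cV[R]_N :=
  ediv uniform_marginal ((gibbs x)^T *m scaling x b).

Definition plan (x : 'M[R]_(n, N)) (b : 'cV[R]_N) : 'M[R]_N :=
  diag_mx (scaling x b)^T *m gibbs x *m diag_mx b^T.

Lemma pos_cone_ediv (M : 'M[R]_N) b :
  (forall i j, 0 < M i j) -> pos_cone b ->
  pos_cone (ediv uniform_marginal (M *m b)).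
Proof.
move=> M0 b0 i; have N0 := leq_ltn_trans (leq0n i) (ltn_ord i).
rewrite 2![in X in _ < X]mxE divr_gt0 ?invr_gt0 ?ltr0n//.
rewrite mxE (bigD1 i)//= ltr_wpDr ?mulr_gt0//.
by apply: sumr_ge0 => j _; rewrite ltW ?mulr_gt0.
Qed.

Lemma sinkhorn_pos x b : pos_cone b -> pos_cone (sinkhorn x b).
Proof.
move=> b0; apply: pos_cone_ediv => [i j|]; first by rewrite !mxE expR_gt0.
by apply: pos_cone_ediv => // i j; rewrite mxE expR_gt0.
Qed.

Lemma edivZr u (r : R) v : ediv u (r *: v) = r^-1 *: ediv u v.
Proof. by apply/matrixP => i j; rewrite !mxE invfM mulrCA. Qed.

Lemma scalingZ x (r : R) b : scaling x (r *: b) = r^-1 *: scaling x b.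
Proof. by rewrite /scaling -scalemxAr edivZr. Qed.

Lemma sinkhornZ x (r : R) b : sinkhorn x (r *: b) = r *: sinkhorn x b.
Proof. by rewrite /sinkhorn scalingZ -scalemxAr edivZr invrK. Qed.

Lemma planZ x (r : R) b : 0 < r -> plan x (r *: b) = plan x b.
Proof.
move=> r0; rewrite /plan scalingZ !linearZ /= -!scalemxAl scalerA.
by rewrite mulfV ?scale1r ?gt_eqF.
Qed.

Definition sinkhorn_cone x (b : @pos_cone R N) : @pos_cone R N :=
  exist _ (sinkhorn x (\val b))
    (mem_set (sinkhorn_pos x (set_mem (valP b)))).

(* On rays the maps act through representatives; [sinkhorn_ray_pi] and
   [plan_ray_pi] below show that the choice of representative is irrelevant. *)
Definition sinkhorn_ray x (q : projective_cone R N) : projective_cone R N :=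
  \pi_(projective_cone R N) (sinkhorn_cone x (repr q)).

Definition plan_ray x (q : projective_cone R N) : 'M[R]_N :=
  plan x (\val (repr q)).

Lemma repr_piP (b : @pos_cone R N) :
  exists2 r : R, 0 < r &
    \val (repr (\pi_(projective_cone R N) b)) = r *: \val b.
Proof.
by apply/asboolP; have /eqmodP := reprK (\pi_{eq_quot (ray_equiv R N)} b).
Qed.

Lemma sinkhorn_ray_pi x b :
  sinkhorn_ray x (\pi b) = \pi_(projective_cone R N) (sinkhorn_cone x b).
Proof.
apply/eqmodP/asboolP; have [r r0 /= e] := repr_piP b.
by exists r => //=; rewrite -sinkhornZ -e.
Qed.

Lemma plan_ray_pi x b : plan_ray x (\pi b) = plan x (\val b).
Proof. by rewrite /plan_ray; have [r r0 ->] := repr_piP b; rewrite planZ. Qed.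

Definition next_x (x : 'M[R]_(n, N)) (q : projective_cone R N) :
    'M[R]_(n, N) :=
  \matrix_(k, i) (Abar i *m col i x
                  + (1%:M - Abar i) *m xtmp i (plan_ray x q)) k 0.

Definition closed_loop (z : state R n N) : state R n N :=
  let x' := next_x z.1 z.2 in (x', sinkhorn_ray x' z.2).

End FixedEps.

Definition xd_perm (s : 'S_N) : 'M[R]_(n, N) := \matrix_(k, i) xd (s i) k 0.

Definition perm_plan (s : 'S_N) : 'M[R]_N :=
  \matrix_(i, j) if j == s i then N%:R^-1 else 0.

(* The norm on matrices is the max norm. *)
Definition cvg_exponentially p q (g : R -> 'M[R]_(p, q)) (l : 'M[R]_(p, q)) :
    Prop :=
  exists2 b : R, 0 < b &
    (fun eps => g eps - l) =O_ (0^'+) (fun eps => expR (- b / eps)).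

Definition equilibrium_family (z : R -> state R n N) : Prop :=
  forall eps, 0 < eps -> equilibrium (closed_loop eps) (z eps).

Definition Exp (s : 'S_N) : set (R -> state R n N) :=
  [set z | [/\ equilibrium_family z,
               cvg_exponentially (fun eps => (z eps).1) (xd_perm s)
             & cvg_exponentially (fun eps => entropic_plan eps (z eps).1)
                 (perm_plan s)]].

End SinkhornMPC.

(* Main.v *)
Require Import Defs.
From mathcomp Require Import all_boot all_order all_algebra all_fingroup.
From mathcomp Require Import all_classical all_reals all_analysis.
From mathcomp Require Import generic_quotient ring lra.

Set Implicit Arguments.
Unset Strict Implicit.
Unset Printing Implicit Defensive.

Import Order.TTheory GRing.Theory Num.Theory.
Import numFieldNormedType.Exports.

Local Open Scope classical_set_scope.
Local Open Scope ring_scope.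

(** Both parts follow from one statement about a single equilibrium
    ([local_stability]), proved by a quadratic Lyapunov function.

    Coordinates. Around an equilibrium [(xe, [betae])] the state is described by
    the deviations [xi_i = x_i - xe_i] and by [theta_j = ln (beta_j / betae_j)]
    up to a common additive constant, normalized to have sum zero. Let [p] be
    [N] times the plan at the equilibrium. It has positive entries, and it is
    doubly stochastic since a ray fixed by the Sinkhorn map is fixed pointwise.
    In these coordinates the next state is an explicit expression in [p], [xi]
    and [theta], built with polynomials, exponentials and logarithms only, and
    its first-order expansion is found by composition.

    Positions. The quadratic form of [calG i] is the minimum energy needed to
    steer to the origin in [tau] steps, and applying the first optimal input
    never increases it. If it stays constant for [tau] steps all the optimal
    inputs vanish, which forces the state to be zero as [A i] is invertible.
    Hence there is a quadratic form [S i] which decreases by at least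
    [|v|^2] when [v] is replaced by [Abar i *m v] ([Abar_lyapunov]).

    Scalings. Write [m_i] for the mean with weights [p i], [Var_i] for the
    corresponding variance, [l_ij] for the linear part of the exponent of the
    Gibbs kernel at the new positions. The linearized update is
      [theta'_j = \sum_i p_ij (m_i theta + (m_i l - l_ij))].
    Jensen's inequality on the columns of [p] gives
      [|theta'|^2 <= |theta|^2 - \sum_i Var_i theta + \sum_i Var_i l],
    because the cross term vanishes. The linearized positions receive from
    [theta] and [xi] a covariance under [p i], controlled by the same variances.
    If each row [p i] has mass at most [d] outside one entry, then [Var_i l] is
    at most of order [d / eps^2 * |xi|^2], and the square of the effect of
    [theta] on [xi_i] is of order [d * Var_i theta]. Therefore
    [mu * \sum_i |xi_i|_S^2 + |theta|^2] decreases strictly as soon as [mu * d]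
    and [d / (mu * eps^2)] are small ([linear_decrease]). It is essential to
    compare with [Var_i theta] and not with [|theta|^2]: for nearly deterministic
    plans the contraction of [theta] is exponentially weak, and only the variances
    degenerate at the same rate as the coupling terms.

    Conclusion. For large [eps] one takes [d = 1] and a small [mu]. For small
    [eps] one takes [mu = 1]; the equilibrium plan is the entropic plan
    ([entropic_plan_softmax]), which is exponentially close to a permutation, so
    that [d] is exponentially small while [eps^2] is only polynomially small. *)

(** * Quadratic forms *)

Section QuadraticForms.
Variables (R : realType) (n : nat).
Implicit Types (S : 'M[R]_n) (u v w : 'cV[R]_n) (a : R).

(** The bilinear form of a square matrix, which need not be symmetric. *)
Definition bf S u v : R := (u^T *m S *m v) 0 0.

(** The squared Euclidean norm. *)
Definition sqnorm v : R := \sum_k v k 0 ^+ 2.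

Lemma bfDl S u v w : bf S (u + v) w = bf S u w + bf S v w.
Proof. by rewrite /bf linearD /= !mulmxDl mxE. Qed.

Lemma bfDr S u v w : bf S u (v + w) = bf S u v + bf S u w.
Proof. by rewrite /bf mulmxDr mxE. Qed.

Lemma bfZl S a u v : bf S (a *: u) v = a * bf S u v.
Proof. by rewrite /bf linearZ /= -!scalemxAl mxE. Qed.

Lemma bfZr S a u v : bf S u (a *: v) = a * bf S u v.
Proof. by rewrite /bf -scalemxAr mxE. Qed.

Lemma bfNl S u v : bf S (- u) v = - bf S u v.
Proof. by rewrite -scaleN1r bfZl mulN1r. Qed.

Lemma bfNr S u v : bf S u (- v) = - bf S u v.
Proof. by rewrite -scaleN1r bfZr mulN1r. Qed.

Lemma bf0 S u : bf S u 0 = 0.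
Proof. by rewrite /bf mulmx0 mxE. Qed.

Definition bfE := (bfDl, bfDr, bfNl, bfNr, bfZl, bfZr).

Lemma bf_sum S u v : bf S u v = \sum_k \sum_l u k 0 * S k l * v l 0.
Proof.
rewrite /bf mxE exchange_big /=; apply: eq_bigr => l _.
by rewrite mxE big_distrl /=; apply: eq_bigr => k _; rewrite mxE.
Qed.

Lemma sqnorm_ge0 v : 0 <= sqnorm v.
Proof. by apply: sumr_ge0 => k _; rewrite sqr_ge0. Qed.

Lemma sqnorm_coord v k : v k 0 ^+ 2 <= sqnorm v.
Proof.
by rewrite /sqnorm (bigD1 k) //= lerDl sumr_ge0 // => l _; rewrite sqr_ge0.
Qed.

Lemma sqnorm_eq0 v : (sqnorm v == 0) = (v == 0).
Proof.
apply/eqP/eqP => [v0|->]; last first.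
  by rewrite /sqnorm big1 // => k _; rewrite mxE expr0n.
apply/colP => k; rewrite mxE; apply/eqP; rewrite -sqrf_eq0 eq_le sqr_ge0 andbT.
by rewrite -v0 sqnorm_coord.
Qed.

Lemma sqnormZ a v : sqnorm (a *: v) = a ^+ 2 * sqnorm v.
Proof. by rewrite /sqnorm mulr_sumr; apply: eq_bigr => k _;
  rewrite mxE exprMn. Qed.

Lemma sqnorm_bf v : sqnorm v = bf 1%:M v v.
Proof.
rewrite /bf mulmx1 mxE; apply: eq_bigr => k _.
by rewrite mxE expr2.
Qed.

Lemma bf1C u v : bf 1%:M u v = bf 1%:M v u.
Proof.
by rewrite /bf !mulmx1 !mxE; apply: eq_bigr => k _; rewrite !mxE mulrC.
Qed.

Lemma bf_mull (M : 'M[R]_n) S u v : bf S (M *m u) v = bf (M^T *m S) u v.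
Proof. by rewrite /bf trmx_mul !mulmxA. Qed.

Lemma bf_mulr (M : 'M[R]_n) S u v : bf S u (M *m v) = bf (S *m M) u v.
Proof. by rewrite /bf !mulmxA. Qed.

Lemma bf_bound S :
  {C : R | 1 <= C & forall u v, bf S u v ^+ 2 <= C * (sqnorm u * sqnorm v)}.
Proof.
pose c := \sum_k \sum_l `|S k l|.
exists (1 + c ^+ 2); first by rewrite lerDl sqr_ge0.
move=> u v.
have c0 : 0 <= c by apply: sumr_ge0 => k _; apply: sumr_ge0.
have H k (w : 'cV[R]_n) : `|w k 0| <= Num.sqrt (sqnorm w).
  by rewrite -sqrtr_sqr ler_sqrt ?sqnorm_coord // sqnorm_ge0.
have H2 : `|bf S u v| <= c * (Num.sqrt (sqnorm u) * Num.sqrt (sqnorm v)).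
  rewrite bf_sum (le_trans (ler_norm_sum _ _ _)) // mulr_suml ler_sum // => k _.
  rewrite (le_trans (ler_norm_sum _ _ _)) // mulr_suml ler_sum // => l _.
  rewrite !normrM [`|u k 0| * _]mulrC -mulrA ler_wpM2l //.
  by rewrite ler_pM ?H.
rewrite -(real_normK (num_real _)).
apply: (@le_trans _ _ ((c * (Num.sqrt (sqnorm u) * Num.sqrt (sqnorm v))) ^+ 2)).
  by rewrite ler_sqr ?nnegrE // !mulr_ge0 ?sqrtr_ge0.
rewrite !exprMn !sqr_sqrtr ?sqnorm_ge0 // ler_wpM2r ?mulr_ge0 ?sqnorm_ge0 //.
by rewrite lerDr ler01.
Qed.

Lemma bf_bound1 S :
  {C : R | 1 <= C & forall v, bf S v v <= C * sqnorm v}.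
Proof.
have [C C1 HC] := bf_bound S; exists C => // v.
have [h|h] := leP (bf S v v) 0.
  by rewrite (le_trans h) // mulr_ge0 ?sqnorm_ge0 // (le_trans ler01).
rewrite -ler_sqr ?nnegrE ?(ltW h) ?mulr_ge0 ?sqnorm_ge0 ?(le_trans ler01) //.
rewrite (le_trans (HC _ _)) // exprMn -expr2 ler_wpM2r ?sqr_ge0 //.
by rewrite expr2 ler_peMr // (le_trans ler01).
Qed.

Lemma sqnorm_mul_bound (M : 'M[R]_n) :
  {C : R | 1 <= C & forall v, sqnorm (M *m v) <= C * sqnorm v}.
Proof.
have [C C1 HC] := bf_bound1 (M^T *m M); exists C => // v.
by rewrite sqnorm_bf bf_mull bf_mulr mulmx1.
Qed.

(** Young's inequality for a positive semidefinite form, not necessarily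
    symmetric. *)
Lemma bf_young S a u v : (forall w, 0 <= bf S w w) -> 0 < a ->
  bf S (u + v) (u + v) <= (1 + a) * bf S u u + (1 + a^-1) * bf S v v.
Proof.
move=> S0 a0; have := S0 (a *: u - v); rewrite !bfE => h.
suff : 0 <= a^-1 * (a * (a * bf S u u) + a * - bf S u v +
   (- (a * bf S v u) + bf S v v)).
  set x := bf S u u; set y := bf S u v; set z := bf S v u; set t := bf S v v.
  rewrite !mulrDr !mulrN !mulrA mulVf ?gt_eqF // !mul1r => {}h.
  lra.
rewrite mulr_ge0 ?invr_ge0 ?(ltW a0) //.
by apply: le_trans h _; lra.
Qed.

(** By compactness of the unit sphere. *)
Lemma posdef_lower_bound S : (forall v, v != 0 -> 0 < bf S v v) ->
  exists2 c, 0 < c & forall v, c * sqnorm v <= bf S v v.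
Proof.
move=> S0.
pose sphere : set 'rV[R]_n := [set x | sqnorm x^T = 1].
pose f (x : 'rV[R]_n) := bf S x^T x^T.
have sqnormT : (fun x : 'rV[R]_n => sqnorm x^T) = fun x => \sum_k x 0 k ^+ 2.
  by apply/funext => x; apply: eq_bigr => k _; rewrite mxE.
have fE : f = fun x => \sum_k \sum_l x 0 k * S k l * x 0 l.
  apply/funext => x; rewrite /f bf_sum; apply: eq_bigr => k _.
  by apply: eq_bigr => l _; rewrite !mxE.
have ccoord (k : 'I_n) : continuous (fun x : 'rV[R]_n => x 0 k).
  exact: coord_continuous.
have cf : continuous f.
  rewrite fE; apply: (continuous_big add_continuous) => k _.
  apply: (continuous_big add_continuous) => l _ x.
  exact: cvgM (cvgM (ccoord k x) (cvg_cst _)) (ccoord l x).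
have cs : continuous (fun x : 'rV[R]_n => sqnorm x^T).
  rewrite sqnormT; apply: (continuous_big add_continuous) => k _ x.
  by rewrite /continuous_at expr2; under eq_fun do rewrite expr2;
    exact: cvgM (ccoord k x) (ccoord k x).
have scale v : v != 0 ->
    exists2 x : 'rV[R]_n, sphere x & bf S v v = sqnorm v * f x.
  move=> v0; have s0 : 0 < sqnorm v by rewrite lt_def sqnorm_eq0 v0 sqnorm_ge0.
  exists ((Num.sqrt (sqnorm v))^-1 *: v^T).
    rewrite /sphere /= linearZ /= trmxK sqnormZ exprVn sqr_sqrtr ?mulVf //.
      by rewrite gt_eqF.
    exact: ltW.
  rewrite /f linearZ /= trmxK bfZl bfZr (mulrA _^-1) -invfM
    -expr2 sqr_sqrtr ?(ltW s0) //.
  by rewrite mulrA divff ?mul1r // gt_eqF.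
have [A0|A0] := pselect (sphere !=set0); last first.
  exists 1 => // v; have [->|/scale[x xs _]] := eqVneq v 0.
    by rewrite bf0 (eqP (_ : sqnorm 0 == 0)) ?mulr0 // sqnorm_eq0.
  by exfalso; apply: A0; exists x.
have cA : compact sphere.
  apply: bounded_closed_compact.
    exists 1; split => // M M1 x xs /=.
    have h k : `|x 0 k| <= M.
      rewrite (le_trans _ (ltW M1)) // -(@ler_pXn2r _ 2) ?nnegrE //.
      rewrite expr1n real_normK ?num_real //.
      by rewrite -xs; have := sqnorm_coord x^T k; rewrite mxE.
    rewrite [leLHS]/Num.norm /= mx_normrE; apply/bigmax_leP; split => /=.
      by rewrite (le_trans _ (ltW M1)).
    by move=> [i k] _ /=; rewrite (ord1 i) h.
  rewrite (_ : sphere = (fun x : 'rV[R]_n => sqnorm x^T) @^-1` [set 1]) //.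
  by apply: closed_comp => [x _|]; [exact: cs|exact: closed_eq].
have [x xs xmin] := EVT_min_rV A0 cA (continuous_subspaceT cf).
rewrite inE in xs.
exists (f x).
  apply: S0; apply/negP => /eqP x0; move: xs; rewrite /sphere /= x0.
  by move/esym/eqP; rewrite (eqP (_ : sqnorm 0 == 0)) ?oner_eq0 // sqnorm_eq0.
move=> v; have [->|/scale[y ys ->]] := eqVneq v 0.
  by rewrite bf0 (eqP (_ : sqnorm 0 == 0)) ?mulr0 // sqnorm_eq0.
by rewrite mulrC ler_wpM2l ?sqnorm_ge0 // xmin // inE.
Qed.

End QuadraticForms.

(** * Minimum-energy feedback and its Lyapunov form *)

Section MatrixPowers.
Variables (R : realType) (n : nat) (A : 'M[R]_n).

Lemma trmx_exp k : (A ^+ k)^T = A^T ^+ k.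
Proof.
elim: k => [|k IH]; first by rewrite !expr0 trmx1.
by rewrite exprSr exprS -mulmxE trmx_mul IH.
Qed.

Lemma unitmx_exp k : A \in unitmx -> A ^+ k \in unitmx.
Proof.
move=> Au; elim: k => [|k IH]; first exact: unitmx1.
by rewrite exprS -mulmxE unitmx_mul Au.
Qed.

End MatrixPowers.

Section MinimumEnergy.
Variables (R : realType) (N n m t : nat).
Variables (A : 'I_N -> 'M[R]_n) (B : 'I_N -> 'M[R]_(n, m)) (i : 'I_N).
Local Notation tau := t.+1.
Hypothesis Gu : reach_gramian tau A B i \in unitmx.
Hypothesis Au : A i \in unitmx.

Local Notation G := (reach_gramian tau A B i).
Local Notation V x := (bf (calG tau A B i) x x).
Local Notation F := (Abar tau A B i).

(** The multiplier of the minimum-energy problem of steering [x] to the origin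
    in [tau] steps. *)
Definition costate (x : 'cV[R]_n) : 'cV[R]_n := invmx G *m (A i ^+ tau *m x).

(** Up to sign, the optimal input to be applied at time [tau.-1 - k]; thus
    [control t] is the first input, and the last one is [control 0]. *)
Definition control (k : nat) (x : 'cV[R]_n) : 'cV[R]_m :=
  (B i)^T *m (A i)^T ^+ k *m costate x.

(** The optimal inputs steer [x] to the origin. *)
Lemma gramian_costate x :
  \sum_(k < tau) A i ^+ k *m B i *m control k x = A i ^+ tau *m x.
Proof.
rewrite -[RHS](mulKVmx Gu) -/(costate x) mulmx_suml.
by apply: eq_bigr => k _; rewrite /control !mulmxA.
Qed.

(** The energy form pairs the optimal inputs with any other inputs that steer
    [x] to the origin. *)
Lemma bf_calG_target (d : nat -> 'cV[R]_m) x :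
  A i ^+ tau *m x = \sum_(k < tau) A i ^+ k *m B i *m d k ->
  V x = \sum_(k < tau) bf 1%:M (d k) (control k x).
Proof.
move=> xd; rewrite /bf /calG.
have -> : x^T *m ((A i ^+ tau)^T *m invmx G *m A i ^+ tau) *m x =
    (A i ^+ tau *m x)^T *m costate x by rewrite trmx_mul /costate !mulmxA.
rewrite xd linear_sum /= mulmx_suml summxE; apply: eq_bigr => k _.
by rewrite /control mulmx1 !trmx_mul trmx_exp !mulmxA.
Qed.

(** The form of [calG] is the minimum energy. *)
Lemma bf_calG x : V x = \sum_(k < tau) sqnorm (control k x).
Proof.
rewrite (@bf_calG_target (control^~ x)) ?gramian_costate //.
by apply: eq_bigr => k _; rewrite sqnorm_bf.
Qed.

Lemma bf_calG_ge0 x : 0 <= V x.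
Proof. by rewrite bf_calG; apply: sumr_ge0 => k _; exact: sqnorm_ge0. Qed.

Lemma Abar_control x : F *m x = A i *m x - B i *m control t x.
Proof. by rewrite /Abar mulmxBl /control /costate !mulmxA. Qed.

(** The optimal inputs at [x] without the first one and followed by a zero
    input; they steer the next state to the origin. *)
Definition shifted (x : 'cV[R]_n) (k : nat) : 'cV[R]_m :=
  if k is k'.+1 then control k' x else 0.

Lemma shifted_feasible x :
  A i ^+ tau *m (F *m x) = \sum_(k < tau) A i ^+ k *m B i *m shifted x k.
Proof.
rewrite Abar_control mulmxBr mulmxA.
have -> : A i ^+ tau *m A i *m x = A i *m (A i ^+ tau *m x).
  by rewrite !mulmxA; congr (_ *m x); by rewrite mulmxE -exprSr exprS.
rewrite -gramian_costate mulmx_sumr big_ord_recr /=.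
rewrite [X in _ = X]big_ord_recl /= mulmx0 add0r.
rewrite -[RHS]addr0 -addrA; congr (_ + _).
  by apply: eq_bigr => k _; rewrite exprS !mulmxA.
by rewrite exprS !mulmxA subrr.
Qed.

(** The energy drop is the energy of the input applied, plus the squared
    distance of the remaining inputs to the new optimal ones. *)
Lemma energy_drop x :
  V x - V (F *m x) = sqnorm (control t x) +
    \sum_(k < tau) sqnorm (shifted x k - control k (F *m x)).
Proof.
have e1 := bf_calG_target (shifted_feasible x).
have e2 := bf_calG (F *m x).
have -> : \sum_(k < tau) sqnorm (shifted x k - control k (F *m x)) =
    \sum_(k < tau) sqnorm (shifted x k) - V (F *m x).
  apply: (@eq_trans _ _ (\sum_(k < tau) sqnorm (shifted x k) -
     (V (F *m x) *+ 2 - V (F *m x)))); last by rewrite mulr2n addrK.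
  rewrite {1}e1 {1}e2 -sumrMnl -!sumrB; apply: eq_bigr => k _.
  rewrite !sqnorm_bf !bfE opprK.
  rewrite (bf1C (control _ _) (shifted _ _)).
  by rewrite mulr2n; ring.
rewrite addrA; congr (_ - _); rewrite bf_calG big_ord_recr /= addrC.
rewrite [in RHS]big_ord_recl /= [X in _ = _ + (X + _)](_ : _ = 0) ?add0r //.
by apply/eqP; rewrite sqnorm_eq0.
Qed.

Lemma energy_drop_ge0 x : V (F *m x) <= V x.
Proof.
by rewrite -subr_ge0 energy_drop addr_ge0 ?sqnorm_ge0 ?sumr_ge0 // => k _;
  exact: sqnorm_ge0.
Qed.

(** Without energy drop the new optimal inputs are the shifted ones, and the
    input just applied is zero: along [s] such steps, the first [s] inputs
    vanish. *)
Lemma no_drop_control s x :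
  (forall r, (r < s)%N ->
     V (iter r (mulmx F) x) <= V (iter r.+1 (mulmx F) x)) ->
  (s <= tau)%N -> forall j, (j < s)%N -> control (t - j) x = 0.
Proof.
elim: s x => [//|s IH] x h st j js.
have := h 0%N erefl; rewrite /= -subr_le0 energy_drop => drop.
have sum0 : 0 <= \sum_(k < tau) sqnorm (shifted x k - control k (F *m x)).
  by apply: sumr_ge0 => k _; exact: sqnorm_ge0.
have ct : control t x = 0.
  apply/eqP; rewrite -sqnorm_eq0 eq_le sqnorm_ge0 andbT.
  by apply: le_trans drop; rewrite lerDl.
case: j js => [|j] js; first by rewrite subn0.
have jt : (t - j < tau)%N by rewrite ltnS leq_subr.
have : shifted x (t - j) = control (t - j) (F *m x).
  apply/eqP; rewrite -subr_eq0 -sqnorm_eq0 eq_le sqnorm_ge0 andbT.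
  apply: le_trans drop; rewrite (bigD1 (Ordinal jt)) //= addrCA lerDl.
  by rewrite addr_ge0 ?sqnorm_ge0 ?sumr_ge0 // => k _; exact: sqnorm_ge0.
rewrite (IH (F *m x)) //; last 2 first.
- by move=> r rs; rewrite -!iterSr; exact: (h r.+1).
- exact: ltnW.
have -> : (t - j = (t - j.+1).+1)%N.
  by rewrite -subSn ?subSS // -ltnS (leq_trans js).
by [].
Qed.

Lemma energy_drop_gt0 x : x != 0 -> V (iter tau (mulmx F) x) < V x.
Proof.
move=> x0; rewrite ltNge; apply/negP => le.
have mono a b : (a <= b)%N -> V (iter b (mulmx F) x) <= V (iter a (mulmx F) x).
  elim: b => [|b IH]; first by rewrite leqn0 => /eqP ->.
  rewrite leq_eqVlt => /predU1P[->//|ab].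
  by rewrite (le_trans _ (IH ab)) //=; exact: energy_drop_ge0.
have c0 k : (k < tau)%N -> control k x = 0.
  rewrite ltnS => kt; rewrite -(subKn kt).
  apply: (@no_drop_control tau) => // [r rt|]; last by rewrite ltnS leq_subr.
  by rewrite (le_trans (mono 0%N r _)) // (le_trans le) // mono.
move/negP: x0; apply; apply/eqP.
have : A i ^+ tau *m x = 0.
  by rewrite -gramian_costate big1 // => k _; rewrite c0 ?mulmx0.
have : A i ^+ tau \in unitmx by exact: unitmx_exp.
by move=> Xu /(congr1 (mulmx (invmx (A i ^+ tau)))); rewrite mulKmx // mulmx0.
Qed.

(** A Lyapunov form for the closed-loop matrix, normalized so that one step
    costs at least the Euclidean norm. *)
Lemma Abar_lyapunov : exists S : 'M[R]_n,
  (forall v, sqnorm v <= bf S v v) /\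
  (forall v, bf S (F *m v) (F *m v) <= bf S v v - sqnorm v).
Proof.
pose S0 : 'M[R]_n := \sum_(k < tau) (F ^+ k)^T *m calG tau A B i *m F ^+ k.
have iterE k v : iter k (mulmx F) v = F ^+ k *m v.
  elim: k => [|k IH]; first by rewrite expr0 mul1mx.
  by rewrite iterS IH exprS mulmxA.
have S0E v : bf S0 v v = \sum_(k < tau) V (iter k (mulmx F) v).
  rewrite /bf /S0 mulmx_sumr mulmx_suml summxE; apply: eq_bigr => k _.
  by rewrite iterE trmx_mul !mulmxA.
pose D := calG tau A B i - (F ^+ tau)^T *m calG tau A B i *m F ^+ tau.
have DE v : bf D v v = V v - V (iter tau (mulmx F) v).
  by rewrite iterE /bf /D mulmxBr mulmxBl trmx_mul !mulmxA [LHS]mxE;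
    congr (_ + _); rewrite mxE.
have D0 v : v != 0 -> 0 < bf D v v.
  by move=> v0; rewrite DE subr_gt0 energy_drop_gt0.
have [c c0 Hc] := posdef_lower_bound D0.
have step v : bf S0 (F *m v) (F *m v) = bf S0 v v - bf D v v.
  rewrite DE !S0E big_ord_recr [X in _ = X - _]big_ord_recl /= -iterSr.
  under eq_bigr do rewrite -iterSr.
  by rewrite /bump /=; ring.
have S0_ge0 v : 0 <= bf S0 v v.
  by rewrite S0E; apply: sumr_ge0 => k _; exact: bf_calG_ge0.
have scaleE v w : bf (c^-1 *: S0) v w = c^-1 * bf S0 v w.
  by rewrite /bf -scalemxAr -scalemxAl mxE.
exists (c^-1 *: S0).
suff H v : bf (c^-1 *: S0) (F *m v) (F *m v) <=
    bf (c^-1 *: S0) v v - sqnorm v.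
  split=> // v; rewrite -subr_ge0; apply: le_trans (H v).
  by rewrite scaleE mulr_ge0 // invr_ge0 ltW.
rewrite !scaleE step mulrBr lerD2l lerN2.
by rewrite mulrC ler_pdivlMr // mulrC.
Qed.

End MinimumEnergy.

(** * Lyapunov's direct method *)

Section Lyapunov.
Variables (R : realType) (T : topologicalType).

(** Lyapunov's direct method for a function whose sublevel sets form a basis
    of neighbourhoods and which is contracted near the equilibrium. *)
Lemma lyapunov_stability (F : T -> T) (e : T) (V : T -> R) (rho : R) :
  equilibrium F e -> (forall z, 0 <= V z) -> 0 <= rho < 1 ->
  (forall U : set T, nbhs e U ->
     exists2 c, 0 < c & forall z, V z < c -> U z) ->
  (forall c, 0 < c -> \forall z \near e, V z < c) ->
  (\forall z \near e, V (F z) <= rho * V z) ->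
  locally_asymptotically_stable F e.
Proof.
move=> Fe V0 /andP[rho0 rho1] Vbasis Vnbhs contr.
have [c0 c00 Hc0] := Vbasis _ contr.
have iterV z k : V z < c0 -> V (iter k F z) <= rho ^+ k * V z.
  move=> zc0; elim: k => [|k IH]; first by rewrite expr0 mul1r.
  rewrite iterS exprS -mulrA (le_trans (Hc0 _ _)) //.
    rewrite (le_lt_trans IH) // (le_lt_trans _ zc0) // ler_piMl //.
    by rewrite exprn_ile1 // ltW.
  by rewrite ler_wpM2l.
split=> //.
  move=> U /Vbasis[c c00' cU].
  have c10 : 0 < Num.min c0 c by rewrite lt_min c00 c00'.
  apply: filterS (Vnbhs _ c10) => z; rewrite lt_min => /andP[zc0 zc] k.
  apply: cU; rewrite (le_lt_trans (iterV _ k zc0)) // (le_lt_trans _ zc) //.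
  by rewrite ler_piMl // exprn_ile1 // ltW.
apply: filterS (Vnbhs _ c00) => z zc0 U /Vbasis[c c00' cU].
have /cvgrPdist_lt/(_ _ c00') : rho ^+ k * V z @[k --> \oo] --> 0.
  rewrite -(mul0r (V z)); apply: cvgMl.
  by apply: cvg_expr; rewrite ger0_norm.
apply: filterS => k; rewrite sub0r normrN => h; apply: cU.
apply: le_lt_trans h; rewrite (le_trans (iterV _ k zc0)) //.
exact: ler_norm.
Qed.

End Lyapunov.

(** * Logarithmic coordinates on the projective cone *)

Section ConeCoordinates.
Local Open Scope quotient_scope.
Variables (R : realType) (N : nat).
Hypothesis N_gt0 : (0 < N)%N.
Local Notation cone := (projective_cone R N).
Local Notation mean f := (N%:R^-1 * \sum_(j < N) f j).

Lemma dim_neq0 : N%:R != 0 :> R. Proof. by rewrite pnatr_eq0 -lt0n. Qed.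

Lemma sum_mean (a : R) : mean (fun=> a) = a.
Proof. by rewrite sumr_const card_ord -[a *+ N]mulr_natl mulrA
  mulVf ?mul1r ?dim_neq0. Qed.

(** [f] minus its arithmetic mean. *)
Definition centered (f : 'I_N -> R) (j : 'I_N) : R := f j - mean f.

Lemma sum_centered f : \sum_j centered f j = 0.
Proof.
rewrite sumrB sumr_const card_ord -[_ *+ N]mulr_natl mulrA.
by rewrite divff ?mul1r ?subrr ?dim_neq0.
Qed.

Lemma centeredD_const f (a : R) : centered (fun j => a + f j) =1 centered f.
Proof.
by move=> j; rewrite /centered big_split mulrDr sum_mean opprD
  addrACA subrr add0r.
Qed.

Lemma eq_centered f g : f =1 g -> centered f =1 centered g.
Proof. by move=> fg j; rewrite /centered fg (eq_bigr g). Qed.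

Lemma sum_centered_sqr_le f : \sum_j centered f j ^+ 2 <= \sum_j f j ^+ 2.
Proof.
rewrite -subr_ge0 -sumrB.
rewrite (_ : \sum_j _ = mean f * \sum_j (centered f j + f j)).
  rewrite big_split /= sum_centered add0r -mulrA mulr_ge0 ?invr_ge0 //.
  by rewrite -expr2 sqr_ge0.
rewrite mulr_sumr; apply: eq_bigr => j _; rewrite /centered; set m := mean f.
ring.
Qed.

Definition log_ratio (b0 b : 'cV[R]_N) (j : 'I_N) : R := ln (b j 0 / b0 j 0).

(** Coordinates on the cone around the ray of [b0]: the logarithms of the
    ratios to [b0], taken up to a common additive constant. *)
Definition cone_coord (b0 : 'cV[R]_N) (q : cone) : 'I_N -> R :=
  centered (log_ratio b0 (\val (repr q))).

Lemma pos_coneP (b : @pos_cone R N) j : 0 < (\val b : 'cV[R]_N) j 0.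
Proof. exact: (set_mem (valP b)). Qed.

Variable b0 : @pos_cone R N.

Lemma log_ratioZ (r : R) (b : 'cV[R]_N) j : 0 < r -> pos_cone b ->
  log_ratio (\val b0) (r *: b) j = ln r + log_ratio (\val b0) b j.
Proof.
move=> r0 bpos; rewrite /log_ratio mxE -mulrA lnM ?posrE ?divr_gt0 //.
exact: pos_coneP.
Qed.

Lemma cone_coord_scale (r : R) (b : 'cV[R]_N) (q : cone) :
  0 < r -> pos_cone b -> \val (repr q) = r *: b ->
  cone_coord (\val b0) q =1 centered (log_ratio (\val b0) b).
Proof.
move=> r0 bpos qb j; rewrite /cone_coord qb.
rewrite -[RHS](centeredD_const _ (ln r)).
by apply: eq_centered => k; rewrite log_ratioZ.
Qed.

Lemma cone_coord_pi (b : @pos_cone R N) :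
  cone_coord (\val b0) (\pi_cone b) =1 centered (log_ratio (\val b0) (\val b)).
Proof.
have [r r0 e] := repr_piP b; apply: cone_coord_scale r0 _ e.
exact: pos_coneP.
Qed.

Lemma cone_coord_self : cone_coord (\val b0) (\pi_cone b0) =1 fun=> 0.
Proof.
move=> j; rewrite cone_coord_pi /centered.
have h k : log_ratio (\val b0) (\val b0) k = 0.
  by rewrite /log_ratio divff ?ln1 // gt_eqF // pos_coneP.
by rewrite h big1 ?mulr0 ?subr0.
Qed.

Lemma sum_cone_coord q : \sum_j cone_coord (\val b0) q j = 0.
Proof. exact: sum_centered. Qed.

(** The positive vector whose logarithmic ratios to [b0] are [th]. *)
Definition exp_point (th : 'I_N -> R) : 'cV[R]_N :=
  \col_j ((\val b0 : 'cV[R]_N) j 0 * expR (th j)).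

Lemma exp_point_pos th : pos_cone (exp_point th).
Proof. by move=> j; rewrite mxE mulr_gt0 ?expR_gt0 // pos_coneP. Qed.

Lemma repr_exp_point q : exists2 r, 0 < r &
  \val (repr q) = r *: exp_point (cone_coord (\val b0) q).
Proof.
set f := log_ratio (\val b0) (\val (repr q)).
exists (expR (mean f)); first exact: expR_gt0.
apply/colP => j; rewrite !mxE mulrCA -expRD /cone_coord /centered addrC subrK.
rewrite /f /log_ratio lnK; last by rewrite posrE divr_gt0 // pos_coneP.
by rewrite mulrCA divff ?mulr1 // gt_eqF // pos_coneP.
Qed.

Lemma centered_log_ratio_cvg (T : Type) (F : set_system T) (FF : Filter F)
    (g : T -> 'cV[R]_N) (b : 'cV[R]_N) j :
  pos_cone b -> (forall k, g y k 0 @[y --> F] --> b k 0) ->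
  centered (log_ratio (\val b0) (g y)) j @[y --> F] -->
    centered (log_ratio (\val b0) b) j.
Proof.
move=> bpos cg.
have clog k : log_ratio (\val b0) (g y) k @[y --> F] -->
  log_ratio (\val b0) b k.
  apply: continuous_cvg; last by apply: cvgMl; exact: cg.
  by apply: continuous_ln; rewrite divr_gt0 //; exact: pos_coneP.
apply: cvgB; first exact: clog.
by apply: cvgMr; apply: (cvg_big add_continuous) => k _; exact: clog.
Qed.

Lemma cone_coord_continuous j :
  continuous (fun q => cone_coord (\val b0) q j).
Proof.
apply/quotient_continuous => b; rewrite /continuous_at /=.
have -> : (fun q => cone_coord (\val b0) q j) \o \pi_cone =
    fun b : @pos_cone R N => centered (log_ratio (\val b0) (\val b)) j.
  by apply/funext => c /=; rewrite cone_coord_pi.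
rewrite cone_coord_pi; apply: (centered_log_ratio_cvg (nbhs_filter b)).
  by move=> k; exact: pos_coneP.
move=> k.
have cv : {for b, continuous (fun x : @pos_cone R N => \val x : 'cV[R]_N)}.
  exact: initial_continuous.
exact: (continuous_comp cv (@coord_continuous R N 1 k 0 _)).
Qed.

(** Every neighbourhood of the ray of [b0] in the quotient topology contains all
    rays with small enough coordinates. *)
Lemma cone_nbhs_coord (U : set cone) : nbhs (\pi_cone b0) U ->
  exists2 c, 0 < c &
    forall q, (forall j, `|cone_coord (\val b0) q j| < c) -> U q.
Proof.
move=> U0.
have := @pi_continuous _ {eq_quot (ray_equiv R N)} b0 U U0;
  rewrite nbhs_filterE.
case=> _ [[W oW <-] /= Wb0 WU].
have : nbhs (\val b0 : 'cV[R]_N) W by move: oW; rewrite openE; exact.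
move/nbhs_ballP => [e /= e0 ballW].
(* the exponential chart is continuous at the origin *)
have chart (j : 'I_N) : exists2 c, 0 < c & forall t, `|t| < c ->
    `|(\val b0 : 'cV[R]_N) j 0 - (\val b0 : 'cV[R]_N) j 0 * expR t| < e.
  have : (\val b0 : 'cV[R]_N) j 0 * expR t @[t --> (0:R)] -->
      (\val b0 : 'cV[R]_N) j 0 * expR 0.
    by apply: cvgMr; exact: continuous_expR.
  rewrite expR0 mulr1 => /cvgrPdist_lt/(_ _ e0)/nbhs_ballP[c /= c0 h].
  by exists c => // t tc; apply: h; rewrite /ball /= sub0r normrN.
pose c j := projT1 (cid2 (chart j)).
have c0 j : 0 < c j by rewrite /c; case: cid2.
have cP j t : `|t| < c j ->
    `|(\val b0 : 'cV[R]_N) j 0 - (\val b0 : 'cV[R]_N) j 0 * expR t| < e.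
  by rewrite /c; case: cid2 => /= ? _; apply.
exists (\big[Order.min/1]_j c j).
  by apply: lt_bigmin => // j _.
move=> q hq; have [r r0 qE] := repr_exp_point q.
pose b : @pos_cone R N := exist (fun v : 'cV[R]_N => v \in @pos_cone R N) _
  (mem_set (exp_point_pos (cone_coord (\val b0) q))).
have -> : q = \pi_cone b.
  rewrite -[q]reprK; apply/eqmodP/asboolP; exists r => //.
apply: WU => /=; apply: ballW; rewrite mx_norm_ball /ball_ /=.
rewrite [ltLHS]/Num.norm /= mx_normrE; apply/bigmax_ltP; split=> // -[j k] _ /=.
rewrite (ord1 k) !mxE; apply: cP; apply: lt_le_trans (hq j) _.
exact: bigmin_le_cond.
Qed.

End ConeCoordinates.

(** * Equilibria and entropic plans *)

Section Softmax.
Local Open Scope quotient_scope.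
Variables (R : realType) (N n m tau : nat).
Hypothesis N_gt0 : (0 < N)%N.
Variables (A : 'I_N -> 'M[R]_n) (B : 'I_N -> 'M[R]_(n, m)).
Variable xd : 'I_N -> 'cV[R]_n.
Local Notation gibbs := (gibbs tau A B xd).
Local Notation plan := (plan tau A B xd).
Local Notation scaling := (scaling tau A B xd).
Local Notation sinkhorn := (sinkhorn tau A B xd).
Implicit Types (x : 'M[R]_(n, N)) (b : 'cV[R]_N).

(** The entries of [K b], where [K] is the Gibbs kernel. *)
Definition row_mass eps x b i : R := \sum_j gibbs eps x i j * b j 0.

(** The row-normalized coupling [diag(K b)^-1 K diag(b)], that is [N] times
    the plan. *)
Definition softmax eps x b i j : R := gibbs eps x i j * b j 0 /
  row_mass eps x b i.

Variable eps : R.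

Lemma gibbs_gt0 x i j : 0 < gibbs eps x i j.
Proof. by rewrite mxE expR_gt0. Qed.

Lemma row_mass_gt0 x b i : pos_cone b -> 0 < row_mass eps x b i.
Proof.
move=> b0; rewrite /row_mass (bigD1 i) //= ltr_wpDr ?mulr_gt0 ?gibbs_gt0 //.
by apply: sumr_ge0 => j _; rewrite ltW // mulr_gt0 ?gibbs_gt0.
Qed.

Lemma scalingE x b i : scaling eps x b i 0 = N%:R^-1 / row_mass eps x b i.
Proof. by rewrite /scaling /ediv mxE mxE; congr (_ / _); rewrite mxE. Qed.

Lemma planE x b i j : plan eps x b i j = N%:R^-1 * softmax eps x b i j.
Proof.
rewrite /plan mul_mx_diag mxE mul_diag_mx mxE.
rewrite [_^T 0 i]mxE [_^T 0 j]mxE scalingE /softmax; ring.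
Qed.

Lemma softmax_gt0 x b i j : pos_cone b -> 0 < softmax eps x b i j.
Proof. by move=> b0; rewrite divr_gt0 ?mulr_gt0 ?gibbs_gt0 ?row_mass_gt0. Qed.

Lemma softmax_row x b i : pos_cone b -> \sum_j softmax eps x b i j = 1.
Proof. by move=> b0; rewrite -mulr_suml divff // gt_eqF // row_mass_gt0. Qed.

Lemma sinkhornE x b j : pos_cone b ->
  sinkhorn eps x b j 0 = (\sum_i gibbs eps x i j / row_mass eps x b i)^-1.
Proof.
move=> b0; rewrite /sinkhorn /ediv mxE mxE mxE.
under eq_bigr do rewrite mxE scalingE mulrCA.
by rewrite -mulr_sumr invfM invrK mulrA mulVf ?mul1r // pnatr_eq0 -lt0n.
Qed.

Lemma xtmpE x b i :
  xtmp xd i (plan eps x b) = \sum_j softmax eps x b i j *: xd j.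
Proof.
rewrite /xtmp scaler_sumr; apply: eq_bigr => j _.
by rewrite planE !scalerA mulrA divff ?mul1r // pnatr_eq0 -lt0n.
Qed.

(** A ray fixed by the Sinkhorn map is fixed pointwise: the total mass of the
    plan, counted by rows and by columns, forces [r = 1]. *)
Lemma sinkhorn_fixed_col x b (r : R) : pos_cone b -> 0 < r ->
  sinkhorn eps x b = r *: b -> forall j, \sum_i softmax eps x b i j = 1.
Proof.
move=> b0 r0 sb.
have colr j : \sum_i softmax eps x b i j = r^-1.
  have /(congr1 (fun c : 'cV[R]_N => c j 0)) := sb.
  rewrite sinkhornE // mxE => /(congr1 (fun t => t^-1)); rewrite invrK.
  move=> h; rewrite /softmax.
  under eq_bigr do rewrite mulrAC.
  by rewrite -mulr_suml h invfM -mulrA mulVf ?mulr1 // gt_eqF.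
have r1 : r^-1 = 1.
  have : \sum_j \sum_i softmax eps x b i j = \sum_(j < N) 1.
    rewrite exchange_big /=; apply: eq_bigr => i _; exact: softmax_row.
  under eq_bigr do rewrite colr.
  rewrite !sumr_const card_ord -[LHS]mulr_natl => /(congr1 (fun
    t => N%:R^-1 * t)).
  by rewrite mulrA mulVf ?mul1r ?mulVf // pnatr_eq0 -lt0n.
by move=> j; rewrite colr r1.
Qed.

Lemma equilibrium_col (z : state R n N) :
  equilibrium (closed_loop tau A B xd eps) z ->
  forall j, \sum_i softmax eps z.1 (\val (repr z.2)) i j = 1.
Proof.
case: z => x q; rewrite /equilibrium /closed_loop /= => -[-> sq].
have b0 : pos_cone (\val (repr q)) by exact: (set_mem (valP (repr q))).
have : sinkhorn_ray tau A B xd eps x q = \pi_(projective_cone R N) (repr q).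
  by rewrite sq reprK.
rewrite /sinkhorn_ray => /eqmodP/asboolP[r r0 e].
exact: (sinkhorn_fixed_col b0 r0 e).
Qed.

Lemma equilibrium_next_x (z : state R n N) :
  equilibrium (closed_loop tau A B xd eps) z ->
  forall i, col i z.1 = Abar tau A B i *m col i z.1 +
   (1%:M - Abar tau A B i) *m
     \sum_j softmax eps z.1 (\val (repr z.2)) i j *: xd j.
Proof.
case: z => x q; rewrite /equilibrium /closed_loop /= => -[ex _] i.
rewrite -{1}ex; apply/colP => k; rewrite mxE mxE.
by rewrite /plan_ray xtmpE.
Qed.

(** The integrand of the relative entropy of positive measures. *)
Definition kl (q p : R) : R := q * (ln q - ln p) - q + p.

Lemma kl_ge0 q p : 0 <= q -> 0 < p -> 0 <= kl q p ?= iff (q == p).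
Proof.
move=> q0 p0; split.
  move: q0; rewrite le_eqVlt => /predU1P[<-|q0].
    by rewrite /kl mul0r subr0 add0r ltW.
  rewrite /kl.
  have : q * (1 + ln (p / q)) <= q * expR (ln (p / q)).
    by rewrite ler_pM2l // expR_ge1Dx.
  rewrite lnK ?posrE ?divr_gt0 // mulrCA divff ?gt_eqF // ln_div ?posrE //.
  lra.
apply/eqP/eqP => [|->]; last by rewrite /kl subrr mulr0 sub0r addNr.
move: q0; rewrite le_eqVlt => /predU1P[<-|q0].
  by rewrite /kl mul0r subr0 add0r.
move=> h; apply/eqP/negPn/negP => qp.
have : q * (1 + ln (p / q)) < q * expR (ln (p / q)).
  rewrite ltr_pM2l // expR_gt1Dx //; apply: contra qp => /eqP l0.
  have : expR (ln (p / q)) = 1 by rewrite l0 expR0.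
  rewrite lnK ?posrE ?divr_gt0 // => /(congr1 (fun t => t * q)) /=.
  by rewrite mul1r divfK ?lt0r_neq0 // => /esym/eqP.
rewrite lnK ?posrE ?divr_gt0 // mulrCA divff ?gt_eqF // ln_div ?posrE //.
move: h; rewrite /kl; lra.
Qed.

(** A coupling of Gibbs form is the unique entropic minimizer: the excess cost
    of any other coupling is its relative entropy. *)
Lemma entropic_plan_softmax x b : 0 < eps -> pos_cone b ->
  (forall j, \sum_i softmax eps x b i j = 1) ->
  entropic_plan tau A B xd eps x = plan eps x b.
Proof.
move=> eps0 b0 colsum; set P := plan eps x b.
have N0 : N%:R != 0 :> R by rewrite pnatr_eq0 -lt0n.
have P0 i j : 0 < P i j.
  by rewrite /P planE mulr_gt0 ?softmax_gt0 // invr_gt0 ltr0n.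
have couplingE (Q : 'M[R]_N) : coupling Q ->
    (forall i, \sum_j Q i j = N%:R^-1) /\ (forall j, \sum_i Q i j = N%:R^-1).
  move=> [_ Qr Qc]; split=> i.
    have := congr1 (fun c : 'cV[R]_N => c i 0) Qr; rewrite !mxE => <-.
    by apply: eq_bigr => j _; rewrite mxE mulr1.
  have := congr1 (fun c : 'cV[R]_N => c i 0) Qc; rewrite !mxE => <-.
  by apply: eq_bigr => j _; rewrite !mxE mulr1.
have Pc : coupling P.
  split; first by move=> i j; exact: ltW.
    apply/colP => i; rewrite !mxE.
    under eq_bigr do rewrite [const_mx _ _ _]mxE mulr1 planE.
    by rewrite -mulr_sumr softmax_row ?mulr1.
  apply/colP => i; rewrite !mxE.
  under eq_bigr do rewrite [const_mx _ _ _]mxE mulr1 [P^T _ _]mxE planE.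
  by rewrite -mulr_sumr colsum ?mulr1.
have al0 i : 0 < scaling eps x b i 0.
  by rewrite scalingE divr_gt0 ?row_mass_gt0 // invr_gt0 ltr0n.
have lnP i j : ln (P i j) =
    ln (scaling eps x b i 0) - cost tau A B xd x i j / eps + ln (b j 0).
  have -> : P i j = scaling eps x b i 0 * gibbs eps x i j * b j 0.
    by rewrite /P planE /softmax scalingE; ring.
  rewrite !lnM ?posrE ?mulr_gt0 ?gibbs_gt0 //.
  by rewrite [gibbs _ _ _ _]mxE expRK mulNr.
pose kap := N%:R^-1 * \sum_i ln (scaling eps x b i 0)
            + N%:R^-1 * \sum_j ln (b j 0) - \sum_i \sum_j P i j.
have costE (Q : 'M[R]_N) : coupling Q ->
    entropic_cost tau A B xd eps x Q =
    eps * (kap + \sum_i \sum_j kl (Q i j) (P i j)).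
  move=> /couplingE[Qr Qc]; rewrite /entropic_cost /kap.
  have -> : N%:R^-1 * \sum_i ln (scaling eps x b i 0) =
      \sum_i \sum_j Q i j * ln (scaling eps x b i 0).
    by rewrite mulr_sumr; apply: eq_bigr => i _; rewrite -mulr_suml Qr.
  have -> : N%:R^-1 * \sum_j ln (b j 0) = \sum_i \sum_j Q i j * ln (b j 0).
    rewrite exchange_big mulr_sumr; apply: eq_bigr => j _.
    by rewrite -mulr_suml Qc.
  rewrite -big_split /= -sumrB -big_split /= !mulr_sumr -big_split /=.
  apply: eq_bigr => i _; rewrite -big_split /= -sumrB -big_split /= !mulr_sumr.
  rewrite -big_split /=; apply: eq_bigr => j _.
  by rewrite /kl lnP; field; rewrite gt_eqF.
have minP Q : coupling Q -> entropic_cost tau A B xd eps x Q <=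
    entropic_cost tau A B xd eps x P -> Q = P.
  move=> Qc; have [Q0 _ _] := Qc.
  rewrite !costE // ler_pM2l // lerD2l.
  have -> : \sum_i \sum_j kl (P i j) (P i j) = 0.
    rewrite big1 // => i _; rewrite big1 // => j _.
    by rewrite /kl subrr mulr0 sub0r addNr.
  have k0 i j : 0 <= kl (Q i j) (P i j) by have [] := kl_ge0 (Q0 i j) (P0 i j).
  have s0 i : 0 <= \sum_j kl (Q i j) (P i j) by apply: sumr_ge0.
  move=> le0; apply/matrixP => i j; apply/eqP.
  have [_ <-] := kl_ge0 (Q0 i j) (P0 i j).
  rewrite eq_le k0 /=; apply: le_trans le0.
  rewrite (bigD1 i) //= (bigD1 j) //= -addrA lerDl addr_ge0 //.
    by apply: sumr_ge0.
  by apply: sumr_ge0.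
have Pm : is_entropic_plan tau A B xd eps x P.
  split=> // Q Qc; rewrite !costE // ler_pM2l // lerD2l.
  rewrite !ler_sum // => i _; rewrite ler_sum // => j _.
  rewrite {1}/kl subrr mulr0 sub0r addNr.
  by have [] := kl_ge0 (let: And3 h _ _ := Qc in h i j) (P0 i j).
rewrite /entropic_plan.
have [Qc Qm] : is_entropic_plan tau A B xd eps x
    (xget 0 (is_entropic_plan tau A B xd eps x)) by apply: xgetPex; exists P.
exact: minP Qc (Qm _ Pc).
Qed.

End Softmax.

(** * Weighted variances and the linearized closed loop *)

Section WeightedVariance.
Variables (R : realType) (I : finType) (w : I -> R).
Hypothesis w_ge0 : forall j, 0 <= w j.
Implicit Types f g : I -> R.

(** Mean and variance of [f] under the weights [w], of total mass one. *)
Definition wmean f : R := \sum_j w j * f j.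
Definition wvar f : R := \sum_j w j * (f j - wmean f) ^+ 2.

Lemma wvar_ge0 f : 0 <= wvar f.
Proof. by apply: sumr_ge0 => j _; rewrite mulr_ge0 ?sqr_ge0. Qed.

Lemma weighted_cauchy_schwarz f g :
  (\sum_j w j * (f j * g j)) ^+ 2 <=
  (\sum_j w j * f j ^+ 2) * (\sum_j w j * g j ^+ 2).
Proof.
have : 0 <= \sum_i \sum_j w i * w j * (f i * g j - f j * g i) ^+ 2.
  apply: sumr_ge0 => i _; apply: sumr_ge0 => j _.
  by rewrite mulr_ge0 ?sqr_ge0 // mulr_ge0.
set D := \sum_i _; set X := \sum_j _; set Y := \sum_j _; set Z := \sum_j _.
suff -> : D = 2 * (Y * Z - X ^+ 2) by rewrite pmulr_rge0 // subr_ge0.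
rewrite mulr2n mulrDl mul1r {1}[Y * Z]mulrC expr2.
rewrite /D /X /Y /Z !big_distrlr /= -!sumrB -big_split /=.
apply: eq_bigr => i _; rewrite -!sumrB -big_split /=.
by apply: eq_bigr => j _; ring.
Qed.

Hypothesis w_sum : \sum_j w j = 1.

Lemma wmeanD f g : wmean (fun j => f j + g j) = wmean f + wmean g.
Proof. by rewrite -big_split; apply: eq_bigr => j _; rewrite mulrDr. Qed.

Lemma wsum_dev f : \sum_j w j * (f j - wmean f) = 0.
Proof.
under eq_bigr do rewrite mulrBr.
by rewrite sumrB -mulr_suml w_sum mul1r subrr.
Qed.

Lemma wvar_shift f a :
  \sum_j w j * (f j - a) ^+ 2 = wvar f + (wmean f - a) ^+ 2.
Proof.
transitivity (\sum_j (w j * (f j - wmean f) ^+ 2 + (w j * (wmean f - a) ^+ 2 +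
    2 * (wmean f - a) * (w j * (f j - wmean f))))).
  by apply: eq_bigr => j _; set c := wmean f; ring.
by rewrite !big_split /= -mulr_sumr -mulr_suml wsum_dev w_sum mul1r mulr0 addr0.
Qed.

Lemma wvar_le f a : wvar f <= \sum_j w j * (f j - a) ^+ 2.
Proof. by rewrite wvar_shift lerDl sqr_ge0. Qed.

Lemma wvarE f : wvar f = \sum_j w j * f j ^+ 2 - wmean f ^+ 2.
Proof.
have -> : \sum_j w j * f j ^+ 2 = \sum_j w j * (f j - 0) ^+ 2.
  by apply: eq_bigr => j _; rewrite subr0.
by rewrite wvar_shift subr0 addrK.
Qed.

Lemma wmean_sqr_le f : wmean f ^+ 2 <= \sum_j w j * f j ^+ 2.
Proof. by rewrite -subr_ge0 -wvarE wvar_ge0. Qed.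

Lemma wvarD_le f g : wvar (fun j => f j + g j) <= 2 * wvar f + 2 * wvar g.
Proof.
rewrite /wvar !mulr_sumr -big_split ler_sum //= => j _; rewrite wmeanD.
set a := wmean f; set b := wmean g.
rewrite ![2 * (w j * _)]mulrCA -mulrDr ler_wpM2l //.
by have := sqr_ge0 ((f j - a) - (g j - b)); rewrite !expr2; lra.
Qed.

(** The covariance of [f] with a vector-valued [d] is controlled by the spread
    of [d] around any point. *)
Lemma sqnorm_wcov n f (d : I -> 'cV[R]_n) (a : 'cV[R]_n) :
  sqnorm (\sum_j (w j * (f j - wmean f)) *: d j) <=
  wvar f * \sum_j w j * sqnorm (d j - a).
Proof.
have -> : \sum_j w j * sqnorm (d j - a) =
    \sum_k \sum_j w j * (d j k 0 - a k 0) ^+ 2.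
  rewrite exchange_big; apply: eq_bigr => j _ /=; rewrite mulr_sumr.
  by apply: eq_bigr => k _; rewrite !mxE.
rewrite mulr_sumr; apply: ler_sum => k _.
apply: le_trans (weighted_cauchy_schwarz _ _).
rewrite le_eqVlt; apply/orP; left; apply/eqP; congr (_ ^+ 2).
transitivity (\sum_j w j * (f j - wmean f) * d j k 0 -
    (\sum_j w j * (f j - wmean f)) * a k 0).
  rewrite wsum_dev mul0r subr0 summxE.
  by apply: eq_bigr => j _; rewrite mxE.
by rewrite mulr_suml -sumrB; apply: eq_bigr => j _; ring.
Qed.

End WeightedVariance.

Lemma wvar_lower_bound (R : realType) (N : nat) (w f : 'I_N -> R) (c : R) :
  (forall j, c <= w j) -> 0 <= c -> \sum_j f j = 0 ->
  c * \sum_j f j ^+ 2 <= wvar w f.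
Proof.
move=> wc c0 f0; apply: (@le_trans _ _ (\sum_j c * (f j - wmean w f) ^+ 2)).
  rewrite -mulr_sumr ler_wpM2l // -subr_ge0 -sumrB.
  have -> : \sum_j ((f j - wmean w f) ^+ 2 - f j ^+ 2) =
      \sum_(j < N) wmean w f ^+ 2 - 2 * wmean w f * \sum_j f j.
    by rewrite mulr_sumr -sumrB; apply: eq_bigr => j _; ring.
  by rewrite f0 mulr0 subr0 sumr_ge0 // => j _; exact: sqr_ge0.
by apply: ler_sum => j _; rewrite ler_wpM2r ?sqr_ge0.
Qed.

Section DoublyStochastic.
Variables (R : realType) (N : nat) (p : 'I_N -> 'I_N -> R).
Hypothesis p_ge0 : forall i j, 0 <= p i j.
Hypothesis p_row : forall i, \sum_j p i j = 1.
Hypothesis p_col : forall j, \sum_i p i j = 1.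

(** The linearized scaling update. Jensen's inequality is applied to the
    columns; the cross term vanishes since the rows of [l] are centered. *)
Lemma scaling_update_contraction (th : 'I_N -> R) (l : 'I_N -> 'I_N -> R) :
  \sum_j (\sum_i p i j * (wmean (p i) th + (wmean (p i) (l i) - l i j))) ^+ 2
  <= \sum_j th j ^+ 2 - \sum_i wvar (p i) th + \sum_i wvar (p i) (l i).
Proof.
apply: (@le_trans _ _ (\sum_j \sum_i
    p i j * (wmean (p i) th + (wmean (p i) (l i) - l i j)) ^+ 2)).
  by apply: ler_sum => j _; apply: (@wmean_sqr_le _ _ (p^~ j)).
rewrite exchange_big /=.
have -> : \sum_j th j ^+ 2 = \sum_i \sum_j p i j * th j ^+ 2.
  rewrite exchange_big; apply: eq_bigr => j _ /=.
  by rewrite -mulr_suml p_col mul1r.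
rewrite -sumrB -big_split /=; apply: ler_sum => i _.
rewrite wvarE // opprB addrCA subrr addr0.
have -> : \sum_j p i j * (wmean (p i) th + (wmean (p i) (l i) - l i j)) ^+ 2 =
    \sum_j p i j * (l i j - (wmean (p i) th + wmean (p i) (l i))) ^+ 2.
  by apply: eq_bigr => j _; congr (_ * _); ring.
by rewrite wvar_shift // opprD addrCA subrr addr0 sqrrN addrC.
Qed.

Variables (n : nat) (S F M : 'I_N -> 'M[R]_n) (xd : 'I_N -> 'cV[R]_n).
Variables (lin : 'I_N -> 'I_N -> 'cV[R]_n -> R) (s : 'I_N -> 'I_N).
Variables (CS CM X L d mu : R).
Hypothesis S_ge : forall i v, sqnorm v <= bf (S i) v v.
Hypothesis S_le : forall i v, bf (S i) v v <= CS * sqnorm v.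
Hypothesis S_step : forall i v,
  bf (S i) (F i *m v) (F i *m v) <= bf (S i) v v - sqnorm v.
Hypothesis M_le : forall i v, sqnorm (M i *m v) <= CM * sqnorm v.
Hypothesis xd_le : forall i j, sqnorm (xd i - xd j) <= X.
Hypothesis lin_le : forall i j k v, (lin i j v - lin i k v) ^+
  2 <= L * sqnorm v.
Hypothesis off_le : forall i, 1 - p i (s i) <= d.
Hypotheses (CS1 : 1 <= CS) (CM0 : 0 <= CM) (X0 : 0 <= X) (L0 : 0 <= L)
  (d0 : 0 <= d) (mu0 : 0 < mu).

Variables (xi : 'I_N -> 'cV[R]_n) (th : 'I_N -> R).

Let y xi i j : R := lin i j (xi i) + th j.

(** The linearized closed loop, for the doubly stochastic matrix [p] given by
    the equilibrium plan. The first-order change of [p i j] caused by the change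
    [y i j] of its log-density is [p i j * (y i j - wmean (p i) (y i))];
    [lin i j] is the linear part of the dependence of the Gibbs kernel on the
    position of agent [i]. *)
Definition lin_x i : 'cV[R]_n := F i *m xi i +
  M i *m \sum_j (p i j * (y xi i j - wmean (p i) (y xi i))) *: xd j.

(** The scalings are updated with the positions already moved, whence
    [lin_x] here. *)
Definition lin_theta j : R :=
  \sum_i p i j * (wmean (p i) (y lin_x i) - lin i j (lin_x i)).

(** The row [p i] has mass at most [d] off [s i]. *)
Lemma wsum_off_le i (f : 'I_N -> R) (c : R) :
  f (s i) = 0 -> (forall j, f j <= c) -> 0 <= c ->
  \sum_j p i j * f j <= d * c.
Proof.
move=> f0 fc c0; rewrite (bigD1 (s i)) //= f0 mulr0 add0r.
apply: (@le_trans _ _ (\sum_(j | j != s i) p i j * c)).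
  by apply: ler_sum => j _; rewrite ler_wpM2l.
rewrite -mulr_suml ler_wpM2r //; apply: le_trans (off_le i).
by rewrite -(p_row i) [X in _ <= X - _](bigD1 (s i)) //= [leRHS]addrC addKr.
Qed.

Lemma wvar_lin_le i v : wvar (p i) (fun j => lin i j v) <= d * L * sqnorm v.
Proof.
apply: le_trans (wvar_le _ _ (lin i (s i) v)) _ => //.
rewrite -mulrA; apply: wsum_off_le => //; first by rewrite subrr expr0n.
by rewrite mulr_ge0 ?sqnorm_ge0.
Qed.

(** The linearization decreases the Lyapunov function
    [mu * \sum_i |xi_i|_S^2 + |th|^2]. The only effect of [th] on [xi] and of
    [xi] on [th] is through the variance, of order [d], of the rows of [p]. *)
Lemma linear_decrease :
  d * L * (4 * CS) <= mu -> 8 * ((1 + 2 * CS) * CS * CM * X) * (mu * d) <= 1 ->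
  mu * (\sum_i bf (S i) (lin_x i) (lin_x i)) + \sum_j lin_theta j ^+ 2 <=
  mu * (\sum_i bf (S i) (xi i) (xi i)) + \sum_j th j ^+ 2
  - mu / 4 * (\sum_i sqnorm (xi i)) - (\sum_i wvar (p i) th) / 2.
Proof.
move=> h1 h2; set C3 := (1 + 2 * CS) * CS * CM * X in h2.
set Q' := \sum_i bf (S i) (lin_x i) _; set Q := \sum_i bf _ _ _.
set X2 := \sum_i sqnorm _; set E := \sum_i wvar _ _.
set T' := \sum_j lin_theta j ^+ 2; set T := \sum_j th j ^+ 2.
pose Vl := \sum_i wvar (p i) (fun j => lin i j (xi i)).
pose Vl' := \sum_i wvar (p i) (fun j => lin i j (lin_x i)).
pose Vy := \sum_i wvar (p i) (y xi i).
(* [eta] bounds the variance of the rows of [lin], see [wvar_lin_le] *)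
pose eta := d * L.
have CS0 : 0 < CS by rewrite (lt_le_trans ltr01).
have eta0 : 0 <= eta by rewrite mulr_ge0.
have E0 : 0 <= E by apply: sumr_ge0 => i _; exact: wvar_ge0.
have X20 : 0 <= X2 by apply: sumr_ge0 => i _; exact: sqnorm_ge0.
have C30 : 0 <= C3 by rewrite !mulr_ge0 // ltW // addr_gt0 // mulr_gt0.
have QX : Q <= CS * X2 by rewrite mulr_sumr; apply: ler_sum => i _; exact: S_le.
have XQ : \sum_i sqnorm (lin_x i) <= Q' by apply: ler_sum => i _; exact: S_ge.
have VlX : Vl <= eta * X2.
  by rewrite mulr_sumr; apply: ler_sum => i _; exact: wvar_lin_le.
have VlX' : Vl' <= eta * Q'.
  apply: le_trans (ler_wpM2l eta0 XQ); rewrite mulr_sumr.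
  by apply: ler_sum => i _; exact: wvar_lin_le.
have VyE : Vy <= 2 * Vl + 2 * E.
  by rewrite !mulr_sumr -big_split; apply: ler_sum => i _; exact: wvarD_le.
have TT : T' <= T - E + Vl'.
  apply: le_trans (scaling_update_contraction th (fun i j =>
    lin i j (lin_x i))).
  apply: ler_sum => j _; rewrite le_eqVlt; apply/orP; left; apply/eqP.
  congr (_ ^+ 2); apply: eq_bigr => i _; congr (_ * _).
  by rewrite /y wmeanD addrAC addrC.
(* The parameter in Young's inequality is chosen so as to give up half of the
   decrease of the positions. *)
have QQ : Q' <= Q - X2 / 2 + C3 * d * Vy.
  rewrite /Q' /Q /X2 /Vy mulr_suml !mulr_sumr -sumrB -big_split.
  apply: ler_sum => i _; rewrite /lin_x /=.
  set h := \sum_j (_ * _) *: _.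
  have S0 w : 0 <= bf (S i) w w by rewrite (le_trans (sqnorm_ge0 w)).
  have a0 : 0 < (2 * CS)^-1 by rewrite invr_gt0 mulr_gt0.
  apply: le_trans (bf_young _ _ S0 a0) _; rewrite invrK.
  have hh : sqnorm h <= wvar (p i) (y xi i) * (d * X).
    apply: le_trans (sqnorm_wcov _ _ _ _ (xd (s i))) _ => //.
    rewrite ler_wpM2l ?wvar_ge0 //; apply: wsum_off_le => //.
    by rewrite subrr; apply/eqP; rewrite sqnorm_eq0.
  apply: lerD.
    have := S_step i (xi i); set q := bf _ (F i *m xi i) _.
    set q0 := bf _ (xi i) _; set x2 := sqnorm (xi i) => st.
    have q0le : (2 * CS)^-1 * q0 <= x2 / 2.
      rewrite mulrC ler_pdivrMr ?mulr_gt0 //.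
      by have := S_le i (xi i); rewrite -/q0 -/x2; lra.
    have : (2 * CS)^-1 * q <= (2 * CS)^-1 * q0.
      rewrite ler_pM2l // (le_trans st) // lerBlDr lerDl; exact: sqnorm_ge0.
    by rewrite [(1 + _) * q]mulrDl mul1r; lra.
  have -> : C3 * d * wvar (p i) (y xi i) =
      (1 + 2 * CS) * (CS * (CM * (wvar (p i) (y xi i) * (d * X)))).
    by rewrite /C3; ring.
  apply: ler_wpM2l; first by rewrite addr_ge0 // mulr_ge0 // ltW.
  apply: le_trans (S_le _ _) _; apply: ler_wpM2l; first exact: ltW.
  by apply: le_trans (M_le _ _) _; exact: ler_wpM2l.
have mueta0 : 0 <= mu + eta by rewrite addr_ge0 // ltW.
have etamu : eta <= mu.
  apply: le_trans h1; rewrite -/eta ler_peMr //.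
  by rewrite (le_trans CS1) // ler_peMl ?(ltW CS0) // ler1n.
have bound : (mu + eta) * (C3 * d * Vy) <= (eta * X2 + E) / 2.
  have -> : (mu + eta) * (C3 * d * Vy) = ((mu + eta) * (C3 * d)) * Vy by ring.
  have a0 : 0 <= (mu + eta) * (C3 * d).
    by rewrite mulr_ge0 // mulr_ge0.
  have a1 : (mu + eta) * (C3 * d) <= 4^-1.
    apply: (@le_trans _ _ (2 * mu * (C3 * d))).
      by rewrite ler_wpM2r ?mulr_ge0 //; lra.
    lra.
  have Vyle : Vy <= 2 * (eta * X2 + E) by lra.
  apply: le_trans (ler_wpM2l a0 Vyle) _.
  have z0 : 0 <= 2 * (eta * X2 + E) by rewrite mulr_ge0 // addr_ge0 // mulr_ge0.
  apply: le_trans (ler_wpM2r z0 a1) _; lra.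
have etaQ : eta * Q <= mu / 4 * X2.
  apply: le_trans (ler_wpM2l eta0 QX) _.
  rewrite mulrA ler_wpM2r //; rewrite -/eta in h1; lra.
have muQ : (mu + eta) * Q' <= (mu + eta) * (Q - X2 / 2 + C3 * d * Vy).
  exact: ler_wpM2l.
have e1 : (mu + eta) * (Q - X2 / 2 + C3 * d * Vy) = mu * Q + eta * Q -
   mu * X2 / 2 - eta * X2 / 2 + (mu + eta) * (C3 * d * Vy) by field.
rewrite e1 [_ * Q']mulrDl in muQ.
lra.
Qed.

End DoublyStochastic.

(** * First-order expansions *)

Section FirstOrder.
Variables (R : realType) (T : Type) (F : set_system T).
Context {FF : Filter F}.
Variable om : T -> R.
Hypothesis om_ge0 : forall z, 0 <= om z.
Hypothesis om_cvg0 : forall c, 0 < c -> \forall z \near F, om z < c.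
Implicit Types (e f g l k : T -> R).

(** [e] is [o(om ^ r)] along [F]. *)
Definition little_o r e : Prop :=
  forall c, 0 < c -> \forall z \near F, `|e z| <= c * om z ^+ r.

(** [e] is [O(om)] along [F]. *)
Definition big_o e : Prop :=
  exists2 C, 0 < C & \forall z \near F, `|e z| <= C * om z.

(** [f] vanishes to first order with linear part [l], where [om] measures the
    size of the argument. *)
Definition first_order f l : Prop := big_o l /\ little_o 1 (fun z => f z - l z).

Lemma little_oD r e f : little_o r e -> little_o r f ->
  little_o r (fun z => e z + f z).
Proof.
move=> he hf c c0; have c20 : 0 < c / 2 by rewrite divr_gt0.
apply: filterS2 (he _ c20) (hf _ c20) => z h1 h2.
by rewrite (le_trans (ler_normD _ _)) // (le_trans (lerD h1
  h2)) // -mulrDl -splitr.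
Qed.

Lemma little_o0 r : little_o r (fun=> 0).
Proof.
move=> c c0; apply: nearW => z; rewrite normr0 mulr_ge0 ?exprn_ge0 //.
exact: ltW.
Qed.

Lemma little_oZ r a e : little_o r e -> little_o r (fun z => a * e z).
Proof.
move=> he c c0; have a0 : 0 < `|a| + 1 by rewrite ltr_wpDl.
have c20 : 0 < c / (`|a| + 1) by rewrite divr_gt0.
apply: filterS (he _ c20) => z h; rewrite normrM.
apply: (@le_trans _ _ ((`|a| + 1) * (c / (`|a| + 1) * om z ^+ r))).
  by apply: ler_pM => //; rewrite lerDl.
by rewrite mulrA mulrCA divff ?mulr1 // gt_eqF.
Qed.

Lemma little_o_sum r (I : Type) (s : seq I) (e : I -> T -> R) :
  (forall i, little_o r (e i)) -> little_o r (fun z => \sum_(i <- s) e i z).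
Proof.
move=> he; elim: s => [|i s IH].
  by under eq_fun do rewrite big_nil; exact: little_o0.
by under eq_fun do rewrite big_cons; exact: little_oD.
Qed.

Lemma big_oD e f : big_o e -> big_o f -> big_o (fun z => e z + f z).
Proof.
move=> [C C0 he] [D D0 hf]; exists (C + D); first exact: addr_gt0.
apply: filterS2 he hf => z h1 h2.
by rewrite (le_trans (ler_normD _ _)) // mulrDl lerD.
Qed.

Lemma big_o0 : big_o (fun=> 0).
Proof. by exists 1 => //; apply: nearW => z; rewrite normr0 mul1r. Qed.

Lemma big_oZ a e : big_o e -> big_o (fun z => a * e z).
Proof.
move=> [C C0 he]; exists ((`|a| + 1) * C); first by rewrite
  mulr_gt0 // ltr_wpDl.
apply: filterS he => z h; rewrite normrM -mulrA.
by apply: ler_pM => //; rewrite lerDl.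
Qed.

Lemma little_o1_big_o e : little_o 1 e -> big_o e.
Proof. by move=> he; exists 1 => //; exact: he. Qed.

Lemma first_order_big_o f l : first_order f l -> big_o f.
Proof.
move=> [bl /little_o1_big_o bs]; have := big_oD bl bs.
by rewrite (_ : (fun z => l z + _) = f) //; apply/funext => z;
  rewrite addrC subrK.
Qed.

Lemma big_o_cvg0 f c : big_o f -> 0 < c -> \forall z \near F, `|f z| < c.
Proof.
move=> [C C0 hf] c0; have cC : 0 < c / C by rewrite divr_gt0.
apply: filterS2 hf (om_cvg0 cC) => z h1 h2; apply: le_lt_trans h1 _.
by rewrite mulrC -ltr_pdivlMr.
Qed.

Lemma big_o_mul f g : big_o f -> big_o g ->
  exists2 C, 0 < C & \forall z \near F, `|f z * g z| <= C * om z ^+ 2.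
Proof.
move=> [C C0 hf] [D D0 hg]; exists (C * D); first exact: mulr_gt0.
apply: filterS2 hf hg => z h1 h2; rewrite normrM expr2 mulrACA.
exact: ler_pM.
Qed.

Lemma little_o_mul f g : little_o 1 f -> big_o g -> little_o 2
  (fun z => f z * g z).
Proof.
move=> hf [D D0 hg] c c0; have cD : 0 < c / D by rewrite divr_gt0.
apply: filterS2 (hf _ cD) hg => z h1 h2; rewrite normrM.
apply: le_trans (ler_pM _ _ h1 h2) _ => //.
by rewrite expr1 mulrACA divfK ?gt_eqF // expr2.
Qed.

Lemma big_o_mul_little_o f g : big_o f -> big_o g -> little_o 1
  (fun z => f z * g z).
Proof.
move=> bf bg c c0; have [C C0 h] := big_o_mul bf bg.
have cC : 0 < c / C by rewrite divr_gt0.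
apply: filterS2 h (om_cvg0 cC) => z h1 h2; apply: le_trans h1 _.
rewrite expr1 expr2 mulrA ler_wpM2r // mulrC -ler_pdivlMr //; exact: ltW.
Qed.

Lemma eq_first_order f f' l l' :
  f =1 f' -> l =1 l' -> first_order f' l' -> first_order f l.
Proof. by move=> /funext -> /funext ->. Qed.

Lemma first_order0 : first_order (fun=> 0) (fun=> 0).
Proof. by split; [exact: big_o0|under eq_fun do rewrite subrr;
  exact: little_o0]. Qed.

Lemma first_orderD f g l k : first_order f l -> first_order g k ->
  first_order (fun z => f z + g z) (fun z => l z + k z).
Proof.
move=> [bl sl] [bk sk]; split; first exact: big_oD.
by under eq_fun do rewrite opprD addrACA; exact: little_oD.
Qed.

Lemma first_orderZ a f l : first_order f l ->
  first_order (fun z => a * f z) (fun z => a * l z).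
Proof.
move=> [bl sl]; split; first exact: big_oZ.
by under eq_fun do rewrite -mulrBr; exact: little_oZ.
Qed.

Lemma first_orderN f l : first_order f l ->
  first_order (fun z => - f z) (fun z => - l z).
Proof.
move=> /(first_orderZ (-1)); apply: eq_first_order => z; by rewrite mulN1r.
Qed.

Lemma first_orderB f g l k : first_order f l -> first_order g k ->
  first_order (fun z => f z - g z) (fun z => l z - k z).
Proof. by move=> hf /first_orderN; exact: first_orderD. Qed.

Lemma first_order_sum (I : Type) (s : seq I) (f l : I -> T -> R) :
  (forall i, first_order (f i) (l i)) ->
  first_order (fun z => \sum_(i <- s) f i z) (fun z => \sum_(i <- s) l i z).
Proof.
move=> h; elim: s => [|i s IH].
  by apply: eq_first_order first_order0 => z; rewrite big_nil.
by apply: eq_first_order (first_orderD (h i) IH) => z; rewrite big_cons.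
Qed.

Lemma first_orderM f g l k : first_order f l -> first_order g k ->
  first_order (fun z => f z * g z) (fun=> 0).
Proof.
move=> hf hg; split; first exact: big_o0.
under eq_fun do rewrite subr0.
by apply: big_o_mul_little_o; apply: first_order_big_o; [exact: hf|exact: hg].
Qed.

Lemma first_order_comp (phi : R -> R) (d : R) f l : phi 0 = 0 ->
  is_derive (0 : R) 1 phi d -> first_order f l ->
  first_order (fun z => phi (f z)) (fun z => d * l z).
Proof.
move=> phi0 phid hf; split; first by apply: big_oZ; case: hf.
have phi_small c : 0 < c -> exists2 t0, 0 < t0 &
    forall t, `|t| < t0 -> `|phi t - d * t| <= c * `|t|.
  move=> c0; have [dphi eqd] := phid.
  have : h^-1 *: ((phi \o shift 0) (h *: 1) - phi 0) @[h --> 0^'] --> d.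
    by rewrite -eqd; exact: dphi.
  move=> /cvgrPdist_le/(_ _ c0)/nbhs_ballP[t0 /= t00 ht0];
    exists t0 => // t tt0.
  have [->|tn0] := eqVneq t 0; first by rewrite phi0 mulr0 subrr normr0 mulr0.
  have := ht0 t; rewrite /ball /= sub0r normrN => /(_ tt0 tn0).
  rewrite addr0 phi0 subr0 /GRing.scale /= mulr1 => h.
  have -> : phi t - d * t = - ((d - t^-1 * phi t) * t).
    by field.
  by rewrite normrN normrM ler_wpM2r.
have [C C0 hC] := first_order_big_o hf.
rewrite (_ : (fun z => _ - _) =
  fun z => (phi (f z) - d * f z) + d * (f z - l z)); last first.
  by apply/funext => z; ring.
apply: little_oD; last by apply: little_oZ; case: hf.
move=> c c0; have cC : 0 < c / C by rewrite divr_gt0.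
have [t0 t00 ht0] := phi_small _ cC.
apply: filterS2 hC (big_o_cvg0 (first_order_big_o hf) t00) => z h1 h2.
rewrite (le_trans (ht0 _ h2)) // expr1.
by rewrite (le_trans (ler_wpM2l (ltW cC) h1)) // mulrA divfK // gt_eqF.
Qed.

Lemma first_order_expRB1 f l : first_order f l ->
  first_order (fun z => expR (f z) - 1) l.
Proof.
move=> hf; have phi0 : expR (0 : R) - 1 = 0 by rewrite expR0 subrr.
have dphi : is_derive (0 : R) 1 (fun t : R => expR t - 1) 1.
  have := is_deriveB (is_derive_expR (0 : R)) (is_derive_cst (1 : R) (0 : R) 1).
  by rewrite expR0 subr0.
apply: eq_first_order (@first_order_comp (fun t => expR t - 1)
  _ _ _ phi0 dphi hf) => z //.
by rewrite mul1r.
Qed.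

Lemma first_order_ln1D f l : first_order f l ->
  first_order (fun z => ln (1 + f z)) l.
Proof.
move=> hf; have phi0 : ln (1 + 0) = 0 :> R by rewrite addr0 ln1.
have dphi : is_derive (0 : R) 1 (fun t : R => ln (1 + t)) 1.
  have dln : is_derive (1 + 0 : R) 1 (@ln R) 1.
    by rewrite addr0 -[X in is_derive _ _ _ X]invr1; exact: is_derive1_ln.
  have dadd : is_derive (0 : R) 1 (fun t : R => 1 + t) 1.
    have := is_deriveD (is_derive_cst (1 : R) (0 : R) 1)
      (is_derive_id (0 : R) 1).
    by rewrite add0r.
  have := @is_derive1_comp _ _ _ _ _ _ dln dadd.
  by rewrite mulr1.
apply: eq_first_order (@first_order_comp (fun t => ln (1 + t))
  _ _ _ phi0 dphi hf) => z //.
by rewrite mul1r.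
Qed.

Lemma first_order_mul_little_o f g l k : first_order f l -> first_order g k ->
  little_o 2 (fun z => f z * g z - l z * k z).
Proof.
move=> hf hg.
rewrite (_ : (fun z => _ - _) =
  fun z => (f z - l z) * g z + (g z - k z) * l z); last first.
  by apply/funext => z; ring.
apply: little_oD; apply: little_o_mul.
- by case: hf.
- exact: first_order_big_o hg.
- by case: hg.
- by case: hf.
Qed.

End FirstOrder.

Section FirstOrderForms.
Variables (R : realType) (T : Type) (F : set_system T).
Context {FF : Filter F}.
Variable om : T -> R.
Hypothesis om_ge0 : forall z, 0 <= om z.
Hypothesis om_cvg0 : forall c, 0 < c -> \forall z \near F, om z < c.
Local Notation first_order := (first_order F om).
Local Notation little_o := (little_o F om).

(** Entrywise first-order expansion. *)
Definition vec_first_order n (f l : T -> 'cV[R]_n) : Prop :=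
  forall k, first_order (fun z => f z k 0) (fun z => l z k 0).

Variable n : nat.
Implicit Types f l : T -> 'cV[R]_n.

Lemma vec_first_orderD f g l k : vec_first_order f l -> vec_first_order g k ->
  vec_first_order (fun z => f z + g z) (fun z => l z + k z).
Proof.
move=> hf hg r.
by apply: eq_first_order (first_orderD (hf r) (hg r)) => z; rewrite mxE.
Qed.

Lemma vec_first_order_mul (M : 'M[R]_n) f l : vec_first_order f l ->
  vec_first_order (fun z => M *m f z) (fun z => M *m l z).
Proof.
move=> hf r; apply: eq_first_order (@first_order_sum _ _ _ _ _ om_ge0 _ _
   (fun j z => M r j * f z j 0) (fun j z => M r j * l z j 0) _) => [z|z|j].
- by rewrite mxE.
- by rewrite mxE.
- exact: first_orderZ.
Qed.

Lemma vec_first_order_lincomb (I : finType) (g k : I -> T -> R)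
    (v : I -> 'cV[R]_n) :
  (forall j, first_order (g j) (k j)) ->
  vec_first_order (fun z => \sum_j g j z *: v j) (fun z => \sum_j k j z *: v j).
Proof.
move=> h r; apply: eq_first_order (@first_order_sum _ _ _ _ _ om_ge0 _ _
   (fun j z => v j r 0 * g j z) (fun j z => v j r 0 * k j z) _) => [z|z|j].
- by rewrite summxE; apply: eq_bigr => j _; rewrite mxE mulrC.
- by rewrite summxE; apply: eq_bigr => j _; rewrite mxE mulrC.
- exact: first_orderZ.
Qed.

Lemma first_order_bfl (S : 'M[R]_n) f l c : vec_first_order f l ->
  first_order (fun z => bf S (f z) c) (fun z => bf S (l z) c).
Proof.
move=> hf; apply: eq_first_order (@first_order_sum _ _ _ _ _ om_ge0 _ _
   (fun j z => (S *m c) j 0 * f z j 0) (fun j z => (S *m c) j 0 * l z j 0) _)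
   => [z|z|j]; last exact: first_orderZ.
- rewrite /bf -mulmxA mxE; apply: eq_bigr => j _; rewrite mulrC.
  by congr (_ * _); rewrite mxE.
- rewrite /bf -mulmxA mxE; apply: eq_bigr => j _; rewrite mulrC.
  by congr (_ * _); rewrite mxE.
Qed.

Lemma first_order_bfr (S : 'M[R]_n) f l c : vec_first_order f l ->
  first_order (fun z => bf S c (f z)) (fun z => bf S c (l z)).
Proof.
move=> hf; apply: eq_first_order (@first_order_sum _ _ _ _ _ om_ge0 _ _
   (fun j z => (c^T *m S) 0 j * f z j 0) (fun j z => (c^T *m S)
     0 j * l z j 0) _)
   => [z|z|j]; last exact: first_orderZ.
- by rewrite /bf mxE.
- by rewrite /bf mxE.
Qed.

Lemma first_order_bf_quad (S : 'M[R]_n) f l : vec_first_order f l ->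
  first_order (fun z => bf S (f z) (f z)) (fun=> 0).
Proof.
move=> hf; apply: (@eq_first_order _ _ _ _ _
   (fun z => \sum_k \sum_l S k l * (f z k 0 * f z l 0)) _
   (fun z => \sum_(k < n) \sum_(l < n) S k l * 0)).
- move=> z; rewrite bf_sum; apply: eq_bigr => k _; apply: eq_bigr => r _.
  by ring.
- by move=> z; rewrite big1 // => k _; rewrite big1 // => r _; rewrite mulr0.
apply: first_order_sum => // k; apply: first_order_sum => // r.
by apply: first_orderZ; apply: first_orderM (hf k) (hf r).
Qed.

Lemma little_o_bf (S : 'M[R]_n) f l : vec_first_order f l ->
  little_o 2 (fun z => bf S (f z) (f z) - bf S (l z) (l z)).
Proof.
move=> hf.
rewrite (_ : (fun z => _ - _) = fun z => \sum_k \sum_r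
    S k r * (f z k 0 * f z r 0 - l z k 0 * l z r 0)); last first.
  apply/funext => z; rewrite !bf_sum -sumrB; apply: eq_bigr => k _.
  by rewrite -sumrB; apply: eq_bigr => r _; ring.
apply: little_o_sum => // k; apply: little_o_sum => // r;
  apply: little_oZ => //.
exact: first_order_mul_little_o (hf k) (hf r).
Qed.

Lemma big_o_first_order (f : T -> R) : big_o F om f -> first_order f f.
Proof.
move=> hf; split=> //; under eq_fun do rewrite subrr; exact: little_o0.
Qed.

End FirstOrderForms.

(** * Stability of a single equilibrium *)

Section LocalStability.
Local Open Scope quotient_scope.
Variables (R : realType) (N n m t : nat).
Hypothesis N_gt0 : (0 < N)%N.
Local Notation tau := t.+1.
Variables (A : 'I_N -> 'M[R]_n) (B : 'I_N -> 'M[R]_(n, m)).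
Variable xd : 'I_N -> 'cV[R]_n.
Hypothesis Gu : forall i, reach_gramian tau A B i \in unitmx.
Variable eps : R.
Hypothesis eps_gt0 : 0 < eps.
Variable ze : state R n N.
Local Notation step := (closed_loop tau A B xd eps).
Hypothesis ze_eq : equilibrium step ze.

Local Notation softmax := (softmax tau A B xd eps).
Local Notation gibbs := (gibbs tau A B xd eps).
Local Notation row_mass := (row_mass tau A B xd eps).
Local Notation G := (calG tau A B).
Local Notation F := (Abar tau A B).
Local Notation b0 := (repr ze.2).
Local Notation be := (\val b0 : 'cV[R]_N).

(** The plan of the equilibrium, with rows normalized to mass one. *)
Definition eq_plan i j : R := softmax ze.1 be i j.
Local Notation p := eq_plan.

(** Deviation of a state from the equilibrium. *)
Definition dev_x (i : 'I_N) (z : state R n N) : 'cV[R]_n := col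
  i z.1 - col i ze.1.
Definition dev_theta (j : 'I_N) (z : state R n N) : R := cone_coord be z.2 j.

(** Exponent of the perturbation of the Gibbs kernel, and its linear part. *)
Definition gibbs_exp i j (v : 'cV[R]_n) : R :=
  - (bf (G i) v (col i ze.1 - xd j) + bf (G i) (col i ze.1 - xd j) v
     + bf (G i) v v) / eps.
Definition gibbs_lin i j (v : 'cV[R]_n) : R :=
  - (bf (G i) v (col i ze.1 - xd j) + bf (G i) (col i ze.1 - xd j) v) / eps.

Lemma eq_scaling_pos : pos_cone be. Proof. by move=> j; exact: pos_coneP. Qed.

Lemma eq_plan_gt0 i j : 0 < p i j. Proof. exact: softmax_gt0
  eq_scaling_pos. Qed.
Lemma eq_plan_expR_gt0 i j e : 0 < p i j * expR e.
Proof. exact: mulr_gt0 (eq_plan_gt0 i j) (expR_gt0 e). Qed.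
Lemma eq_plan_row i : \sum_j p i j = 1. Proof. exact:
  softmax_row eq_scaling_pos. Qed.
Lemma eq_plan_col j : \sum_i p i j = 1. Proof. exact: equilibrium_col. Qed.

Lemma costE x i j :
  cost tau A B xd x i j = bf (G i) (col i x - xd j) (col i x - xd j).
Proof. by rewrite mxE /wnorm sqr_sqrtr //; exact: bf_calG_ge0. Qed.

Lemma gibbs_perturb i j x :
  gibbs x i j = gibbs ze.1 i j * expR (gibbs_exp i j (col i x - col i ze.1)).
Proof.
rewrite mxE [gibbs ze.1 i j]mxE -expRD; congr expR; rewrite !costE /gibbs_exp.
have -> : col i x - xd j = (col i x - col i ze.1) + (col i ze.1 - xd j).
  by rewrite addrA subrK.
set v := col i x - _; set c := col i ze.1 - _; rewrite !bfDl !bfDr; field.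
by rewrite gt_eqF.
Qed.

(** The plan and the scaling update at a perturbed state, written with the
    equilibrium plan and the exponents [L i j + th j]. *)
Section Perturbation.
Variables (x : 'M[R]_(n, N)) (b : 'cV[R]_N) (th : 'I_N -> R) (r : R).
Hypothesis r_gt0 : 0 < r.
Hypothesis bE : b = r *: exp_point b0 th.
Local Notation L i j := (gibbs_exp i j (col i x - col i ze.1)).

Lemma scaled_entry k : b k 0 = r * (be k 0 * expR (th k)).
Proof. by rewrite bE !mxE. Qed.

Lemma row_mass_perturb i : row_mass x b i =
  r * row_mass ze.1 be i * \sum_k p i k * expR (L i k + th k).
Proof.
rewrite -mulrA [row_mass ze.1 _ _ * _]mulr_sumr mulr_sumr /row_mass.
apply: eq_bigr => k _; rewrite gibbs_perturb expRD scaled_entry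
  /eq_plan /softmax.
rewrite -/(row_mass ze.1 be i); field.
by rewrite gt_eqF // row_mass_gt0 //; exact: eq_scaling_pos.
Qed.

Lemma normalizer_gt0 i : 0 < \sum_k p i k * expR (L i k + th k).
Proof.
rewrite (bigD1 i) //= ltr_wpDr ?eq_plan_expR_gt0 //.
by apply: sumr_ge0 => k _; rewrite ltW // eq_plan_expR_gt0.
Qed.

(** The logarithm of [\sum_k p i k * expR (L i k + th k)], in a form suited to
    expansion at the equilibrium. *)
Definition log_normalizer i : R :=
  ln (1 + \sum_k p i k * (expR (L i k + th k) - 1)).

Lemma expR_log_normalizer i :
  expR (log_normalizer i) = \sum_k p i k * expR (L i k + th k).
Proof.
rewrite /log_normalizer.
have -> : 1 + \sum_k p i k * (expR (L i k + th k) - 1) =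
    \sum_k p i k * expR (L i k + th k).
  by under eq_bigr do rewrite mulrBr mulr1; rewrite sumrB
    eq_plan_row addrC subrK.
by rewrite lnK // posrE normalizer_gt0.
Qed.

Lemma softmax_perturb i j :
  softmax x b i j = p i j * expR (L i j + th j - log_normalizer i).
Proof.
rewrite expRD expRN expR_log_normalizer /softmax row_mass_perturb.
rewrite gibbs_perturb expRD scaled_entry /eq_plan /softmax.
set Z := \sum_k _; have Z0 : Z != 0 by rewrite gt_eqF // normalizer_gt0.
have w0 : row_mass ze.1 be i != 0 by rewrite gt_eqF // row_mass_gt0 //;
  exact: eq_scaling_pos.
by field; rewrite Z0 w0 gt_eqF.
Qed.

Lemma log_ratio_sinkhorn j :
  log_ratio be (sinkhorn tau A B xd eps x b) j = ln r -
  ln (1 + \sum_i p i j * (expR (L i j - log_normalizer i) - 1)).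
Proof.
have be0 := eq_scaling_pos j.
have b_pos : pos_cone b.
  by move=> k; rewrite bE mxE mulr_gt0 //; exact: exp_point_pos.
have W0 : 0 < \sum_i p i j * expR (L i j - log_normalizer i).
  rewrite (bigD1 j) //= ltr_wpDr ?eq_plan_expR_gt0 //.
  by apply: sumr_ge0 => k _; rewrite ltW // eq_plan_expR_gt0.
have -> : 1 + \sum_i p i j * (expR (L i j - log_normalizer i) - 1) =
    \sum_i p i j * expR (L i j - log_normalizer i).
  by under eq_bigr do rewrite mulrBr mulr1; rewrite sumrB
    eq_plan_col addrC subrK.
rewrite /log_ratio sinkhornE //.
have -> : \sum_i gibbs x i j / row_mass x b i =
    (r * be j 0)^-1 * \sum_i p i j * expR (L i j - log_normalizer i).
  rewrite mulr_sumr; apply: eq_bigr => i _.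
  rewrite row_mass_perturb gibbs_perturb expRD expRN expR_log_normalizer.
  rewrite /eq_plan /softmax -/(row_mass ze.1 be i).
  set Z := \sum_k _; have Z0 : Z != 0 by rewrite gt_eqF // normalizer_gt0.
  have w0 : row_mass ze.1 be i != 0.
    by rewrite gt_eqF // row_mass_gt0 //; exact: eq_scaling_pos.
  by field; rewrite Z0 w0 !gt_eqF.
rewrite invfM invrK mulrAC mulfK ?gt_eqF // ln_div ?posrE //.
Qed.

End Perturbation.

Section LyapunovFunction.
Variables (S : 'I_N -> 'M[R]_n) (mu : R).
Hypothesis S_ge : forall i v, sqnorm v <= bf (S i) v v.
Hypothesis mu_gt0 : 0 < mu.

(** The Lyapunov function and its square root, which measures the distance to
    the equilibrium in the first-order expansions. *)
Definition lyap (z : state R n N) : R :=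
  mu * (\sum_i bf (S i) (dev_x i z) (dev_x i z)) + \sum_j dev_theta j z ^+ 2.

Definition lyap_size z : R := Num.sqrt (lyap z).
Local Notation om := lyap_size.

Lemma S_ge0 i v : 0 <= bf (S i) v v.
Proof. exact: le_trans (sqnorm_ge0 v) (S_ge i v). Qed.

Lemma lyap_ge0 z : 0 <= lyap z.
Proof.
apply: addr_ge0; last by apply: sumr_ge0 => j _; exact: sqr_ge0.
by apply: mulr_ge0; [exact: ltW|apply: sumr_ge0 => i _; exact: S_ge0].
Qed.

Lemma lyap_size_ge0 z : 0 <= om z. Proof. exact: sqrtr_ge0. Qed.

Lemma lyap_size_sqr z : om z ^+ 2 = lyap z.
Proof. by rewrite sqr_sqrtr // lyap_ge0. Qed.

Lemma dev_theta_le j z : dev_theta j z ^+ 2 <= lyap z.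
Proof.
rewrite /lyap [X in _ + X](bigD1 j) //= addrCA lerDl addr_ge0 //.
  by apply: mulr_ge0; [exact: ltW|apply: sumr_ge0 => i _; exact: S_ge0].
by rewrite sumr_ge0 // => i _; exact: sqr_ge0.
Qed.

Lemma dev_x_le i k z : dev_x i z k 0 ^+ 2 <= mu^-1 * lyap z.
Proof.
rewrite mulrDr mulrA mulVf ?gt_eqF // mul1r.
apply: le_trans (sqnorm_coord _ k) _; apply: le_trans (S_ge i _) _.
rewrite (bigD1 i) //= -addrA lerDl addr_ge0 //.
  by rewrite sumr_ge0 // => r _; exact: S_ge0.
apply: mulr_ge0; first by rewrite invr_ge0 ltW.
by apply: sumr_ge0 => r _; exact: sqr_ge0.
Qed.

Lemma dev_x_cvg i k : dev_x i z k 0 @[z --> ze] --> (0 : R).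
Proof.
have -> : (fun z => dev_x i z k 0) = fun z : state R n N => z.1 k i - ze.1 k i.
  by apply/funext => z; rewrite /dev_x !mxE.
rewrite -(subrr (ze.1 k i)); apply: cvgB; last exact: cvg_cst.
have c1 : {for ze, continuous (fun z : state R n N => z.1)} by exact: cvg_fst.
exact: (continuous_comp c1 (@coord_continuous R n N k i _)).
Qed.

Lemma dev_theta_cvg j : dev_theta j z @[z --> ze] --> (0 : R).
Proof.
have e0 : dev_theta j ze = 0.
  by rewrite /dev_theta -{2}[ze.2]reprK cone_coord_self.
rewrite -e0.
have c2 : {for ze, continuous (fun z : state R n N => z.2)} by exact: cvg_snd.
exact: (continuous_comp c2 (@cone_coord_continuous _ _ N_gt0 b0 j _)).
Qed.

Lemma lyap_near c : 0 < c -> \forall z \near ze, lyap z < c.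
Proof.
move=> c0.
have : lyap z @[z --> ze] --> mu * (\sum_i \sum_k \sum_l 0 * S i k l * 0) +
    \sum_(j < N) (0 : R) * 0.
  have -> : lyap = fun z => mu * (\sum_i \sum_k \sum_l
      dev_x i z k 0 * S i k l * dev_x i z l 0) +
      \sum_j dev_theta j z * dev_theta j z.
    apply/funext => z; rewrite /lyap; congr (mu * _ + _).
    by apply: eq_bigr => i _; rewrite bf_sum.
  apply: cvgD.
    apply: cvgMr; apply: (cvg_big add_continuous) => i _.
    apply: (cvg_big add_continuous) => k _.
    apply: (cvg_big add_continuous) => l _.
    apply: cvgM (dev_x_cvg i l); apply: cvgMl; exact: dev_x_cvg.
  apply: (cvg_big add_continuous) => j _.
  exact: cvgM (dev_theta_cvg j) (dev_theta_cvg j).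
rewrite [X in _ --> X](_ : _ = 0); last first.
  rewrite [X in mu * X]big1 ?mulr0 ?add0r => [|i _].
    by rewrite big1 // => j _; rewrite mul0r.
  by rewrite big1 // => k _; rewrite big1 // => l _; rewrite mulr0.
move=> /cvgrPdist_lt/(_ _ c0); apply: filterS => z.
by rewrite sub0r normrN ger0_norm // lyap_ge0.
Qed.

Lemma lyap_size_near c : 0 < c -> \forall z \near ze, om z < c.
Proof.
move=> c0; have c20 : 0 < c ^+ 2 by rewrite exprn_gt0.
apply: filterS (lyap_near c20) => z h.
by rewrite -(@ltr_pXn2r _ 2) ?nnegrE ?sqrtr_ge0 ?(ltW c0) // lyap_size_sqr.
Qed.

Lemma lyap_basis (U : set (state R n N)) : nbhs ze U ->
  exists2 c, 0 < c & forall z, lyap z < c -> U z.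
Proof.
case=> -[P Q] /= [nP nQ] PQU.
have nQ' : nbhs (\pi_(projective_cone R N) b0) Q by rewrite reprK.
have [c1 c10 hQ] := cone_nbhs_coord nQ'.
move/nbhs_ballP : nP => [c2 /= c20 hP].
exists (Num.min (c1 ^+ 2) (mu * c2 ^+ 2)).
  by rewrite lt_min !exprn_gt0 //= mulr_gt0 ?exprn_gt0.
move=> z; rewrite lt_min => /andP[h1 h2]; apply: PQU; split => /=.
  apply: hP; rewrite mx_norm_ball /ball_ /=.
  rewrite [ltLHS]/Num.norm /= mx_normrE; apply/bigmax_ltP;
    split=> // -[k i] _ /=.
  rewrite -(@ltr_pXn2r _ 2) ?nnegrE ?(ltW c20) // real_normK ?num_real //.
  have := dev_x_le i k z; rewrite !mxE -sqrrN opprB => /le_lt_trans; apply.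
  by rewrite mulrC ltr_pdivrMr // mulrC.
apply: hQ => j; rewrite -(@ltr_pXn2r _ 2) ?nnegrE ?(ltW c10) //.
rewrite real_normK ?num_real //; apply: le_lt_trans h1; exact: dev_theta_le.
Qed.

Local Notation fo := (first_order (nbhs ze) om).
Local Notation vfo := (vec_first_order (nbhs ze) om).

#[local] Hint Resolve lyap_size_ge0 : core.

Lemma dev_x_first_order i : vfo (dev_x i) (dev_x i).
Proof.
move=> k; apply: big_o_first_order => //.
exists (Num.sqrt mu^-1); first by rewrite sqrtr_gt0 invr_gt0.
apply: nearW => z; rewrite /om -sqrtrM; last by rewrite invr_ge0 ltW.
by rewrite -sqrtr_sqr ler_wsqrtr // dev_x_le.
Qed.

Lemma dev_theta_first_order j : fo (dev_theta j) (dev_theta j).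
Proof.
apply: big_o_first_order => //.
exists 1 => //; apply: nearW => z; rewrite mul1r -sqrtr_sqr.
by rewrite ler_wsqrtr // dev_theta_le.
Qed.

Lemma gibbs_exp_first_order i j (f l : state R n N -> 'cV[R]_n) : vfo f l ->
  fo (fun z => gibbs_exp i j (f z)) (fun z => gibbs_lin i j (l z)).
Proof.
move=> hf; pose c := col i ze.1 - xd j.
have h1 : fo (fun z => bf (G i) (f z) c) (fun z => bf (G i) (l z) c).
  exact: first_order_bfl.
have h2 : fo (fun z => bf (G i) c (f z)) (fun z => bf (G i) c (l z)).
  exact: first_order_bfr.
have h3 : fo (fun z => bf (G i) (f z) (f z)) (fun=> 0).
  by apply: first_order_bf_quad hf => // c1 c10; exact: lyap_size_near.
apply: eq_first_order (first_orderZ (- eps^-1)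
  (first_orderD (first_orderD h1 h2) h3)) => z;
    rewrite /gibbs_exp /gibbs_lin -/c.
  by rewrite mulNr [_ * eps^-1]mulrC mulNr.
by rewrite addr0 mulNr [_ * eps^-1]mulrC mulNr.
Qed.

Section Normalizer.
Variables (X : state R n N -> 'M[R]_(n, N)) (l : 'I_N -> state
  R n N -> 'cV[R]_n).
Hypothesis Xl : forall i, vfo (fun z => col i (X z) - col i ze.1) (l i).
Local Notation y i j z := (gibbs_lin i j (l i z) + dev_theta j z).

Lemma log_normalizer_first_order i :
  fo (fun z => log_normalizer (X z) (dev_theta^~ z) i)
     (fun z => wmean (p i) (fun j => y i j z)).
Proof.
apply: first_order_ln1D => //; first exact: lyap_size_near.
apply: first_order_sum => // k; apply: first_orderZ => //.
apply: first_order_expRB1 => //; first exact: lyap_size_near.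
apply: first_orderD; last exact: dev_theta_first_order.
exact: gibbs_exp_first_order.
Qed.

Lemma softmax_dev_first_order i j : fo
  (fun z => p i j * (expR (gibbs_exp i j (col i (X z) - col i ze.1)
      + dev_theta j z - log_normalizer (X z) (dev_theta^~ z) i) - 1))
  (fun z => p i j * (y i j z - wmean (p i) (fun k => y i k z))).
Proof.
apply: first_orderZ => //.
apply: first_order_expRB1 => //; first exact: lyap_size_near.
apply: first_orderB => //; last exact: log_normalizer_first_order.
apply: first_orderD; last exact: dev_theta_first_order.
exact: gibbs_exp_first_order.
Qed.

Lemma scaling_dev_first_order j : fo
  (fun z => - ln (1 + \sum_i p i j * (expR (
      gibbs_exp i j (col i (X z) - col i ze.1)
      - log_normalizer (X z) (dev_theta^~ z) i) - 1)))
  (fun z => \sum_i p i j *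
     (wmean (p i) (fun k => y i k z) - gibbs_lin i j (l i z))).
Proof.
have : fo (fun z => - ln (1 + \sum_i p i j * (expR (
      gibbs_exp i j (col i (X z) - col i ze.1)
      - log_normalizer (X z) (dev_theta^~ z) i) - 1)))
  (fun z => - \sum_i p i j *
     (gibbs_lin i j (l i z) - wmean (p i) (fun k => y i k z))).
  apply: first_orderN => //.
  apply: first_order_ln1D => //; first exact: lyap_size_near.
  apply: first_order_sum => // i; apply: first_orderZ => //.
  apply: first_order_expRB1 => //; first exact: lyap_size_near.
  apply: first_orderB => //; last exact: log_normalizer_first_order.
  exact: gibbs_exp_first_order.
apply: eq_first_order => // z; rewrite -sumrN; apply: eq_bigr => i _.
set a := wmean _ _; set g := gibbs_lin _ _ _; ring.
Qed.

End Normalizer.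

Local Notation M := (fun i => 1%:M - F i).
(** The linearization of the closed loop at the equilibrium. *)
Definition next_lin_x i z :=
  lin_x p F M xd gibbs_lin (dev_x^~ z) (dev_theta^~ z) i.
Definition next_lin_theta j z :=
  lin_theta p F M xd gibbs_lin (dev_x^~ z) (dev_theta^~ z) j.

Lemma dev_x_step i z : dev_x i (step z) = F i *m dev_x i z + (1%:M - F i) *m
  \sum_j (p i j * (expR (gibbs_exp i j (col i z.1 - col i ze.1) + dev_theta j z
     - log_normalizer z.1 (dev_theta^~ z) i) - 1)) *: xd j.
Proof.
have [r r0 bE] := repr_exp_point b0 z.2.
have -> : dev_x i (step z) = F i *m col i z.1 + (1%:M - F i) *m
    (\sum_j softmax z.1 (\val (repr z.2)) i j *: xd j) - col i ze.1.
  congr (_ - _); apply/colP => k; rewrite mxE mxE /plan_ray xtmpE //.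
transitivity (F i *m col i z.1 + (1%:M - F i) *m
    (\sum_j softmax z.1 (\val (repr z.2)) i j *: xd j)
    - (F i *m col i ze.1 + (1%:M - F i) *m \sum_j p i j *: xd j)).
  by congr (_ - _); exact: (equilibrium_next_x N_gt0 ze_eq).
rewrite (opprD (F i *m _)) addrACA -!mulmxBr.
congr (_ + _ *m _); rewrite -sumrB; apply: eq_bigr => j _.
by rewrite (softmax_perturb _ r0 bE) -scalerBl mulrBr mulr1.
Qed.

Lemma dev_x_step_first_order i :
  vfo (fun z => dev_x i (step z)) (next_lin_x i).
Proof.
rewrite (_ : (fun z => _) = fun z => F i *m dev_x i z + (1%:M - F i) *m
  \sum_j (p i j * (expR (gibbs_exp i j (col i z.1 - col i ze.1) + dev_theta j z
     - log_normalizer z.1 (dev_theta^~ z) i) - 1)) *: xd j); last first.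
  by apply/funext => z; exact: dev_x_step.
apply: vec_first_orderD => //.
  by apply: vec_first_order_mul => //; exact: dev_x_first_order.
apply: vec_first_order_mul => //.
apply: vec_first_order_lincomb => // j.
by apply: softmax_dev_first_order => k; exact: dev_x_first_order.
Qed.

(** The logarithmic ratios of the next scaling to the equilibrium one, up to an
    additive constant that centering removes. *)
Definition theta_step j z : R :=
  - ln (1 + \sum_i p i j * (expR (
      gibbs_exp i j (dev_x i (step z))
      - log_normalizer (step z).1 (dev_theta^~ z) i) - 1)).

Lemma dev_theta_step_le z :
  \sum_j dev_theta j (step z) ^+ 2 <= \sum_j theta_step j z ^+ 2.
Proof.
have [r r0 bE] := repr_exp_point b0 z.2.
apply: le_trans (sum_centered_sqr_le N_gt0 (theta_step^~ z)).
apply: ler_sum => j _; rewrite le_eqVlt; apply/orP; left; apply/eqP.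
congr (_ ^+ 2); rewrite /dev_theta cone_coord_pi //.
rewrite -[RHS](centeredD_const N_gt0 _ (ln r)); apply: eq_centered => k /=.
exact: (log_ratio_sinkhorn _ r0 bE).
Qed.

Lemma theta_step_first_order j : fo (theta_step j) (next_lin_theta j).
Proof.
exact: (scaling_dev_first_order (X := fun z => (step z).1)
  dev_x_step_first_order).
Qed.

(** A strict decrease of the Lyapunov function along the linearization persists,
    up to a factor, for the closed loop near the equilibrium. *)
Lemma lyap_step_near (k : R) : 0 < k ->
  (forall z, mu * (\sum_i bf (S i) (next_lin_x i z) (next_lin_x i z)) +
     \sum_j next_lin_theta j z ^+ 2 <= (1 - k) * lyap z) ->
  \forall z \near ze, lyap (step z) <= (1 - k / 2) * lyap z.
Proof.
move=> k0 lin_le.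
have sx : little_o (nbhs ze) om 2 (fun z => mu * (\sum_i
    (bf (S i) (dev_x i (step z)) (dev_x i (step z))
     - bf (S i) (next_lin_x i z) (next_lin_x i z)))).
  apply: little_oZ => //.
  apply: little_o_sum => // i; apply: little_o_bf => //;
    exact: dev_x_step_first_order.
have st : little_o (nbhs ze) om 2 (fun z => \sum_j
    (theta_step j z * theta_step j z - next_lin_theta j z *
      next_lin_theta j z)).
  apply: little_o_sum => // j; apply: first_order_mul_little_o
    (theta_step_first_order j)
    (theta_step_first_order j) => //.
have k20 : 0 < k / 2 by rewrite divr_gt0.
apply: filterS (little_oD (FF := nbhs_filter ze) sx st k20) => z.
rewrite lyap_size_sqr => /(le_trans (ler_norm _)); rewrite !sumrB => h.
apply: (@le_trans _ _ (mu * (\sum_i bf (S i) (dev_x i (step z))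
  (dev_x i (step z)))
    + \sum_j theta_step j z ^+ 2)).
  by rewrite lerD2l; exact: dev_theta_step_le.
have := lin_le z.
have sq (g : 'I_N -> R) : \sum_j g j ^+ 2 = \sum_j g j * g j.
  by apply: eq_bigr => j _; rewrite expr2.
rewrite !sq => h2.
rewrite mulrBr in h.
rewrite [leRHS]mulrBl mul1r; rewrite [leRHS]mulrBl mul1r in h2.
lra.
Qed.

Section Decrease.
Variables (s : 'I_N -> 'I_N) (CS CM CG X d : R).
Hypothesis S_le : forall i v, bf (S i) v v <= CS * sqnorm v.
Hypothesis S_step : forall i v,
  bf (S i) (F i *m v) (F i *m v) <= bf (S i) v v - sqnorm v.
Hypothesis M_le : forall i v, sqnorm ((1%:M - F i) *m v) <= CM * sqnorm v.
Hypothesis xd_le : forall i j, sqnorm (xd i - xd j) <= X.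
Hypothesis G_le : forall i u v, bf (G i) u v ^+ 2 <= CG * (sqnorm u * sqnorm v).
Hypothesis off_le : forall i, 1 - p i (s i) <= d.
Hypotheses (CS1 : 1 <= CS) (CM0 : 0 <= CM) (CG0 : 0 <= CG) (X0
  : 0 <= X) (d0 : 0 <= d).

Lemma gibbs_lin_spread i j k v :
  (gibbs_lin i j v - gibbs_lin i k v) ^+ 2 <= 4 * CG * X / eps ^+ 2 * sqnorm v.
Proof.
have -> : gibbs_lin i j v - gibbs_lin i k v =
    (bf (G i) v (xd j - xd k) + bf (G i) (xd j - xd k) v) / eps.
  by rewrite /gibbs_lin !bfE; field; rewrite gt_eqF.
set a := bf _ _ _; set b := bf _ _ _.
have ha : a ^+ 2 <= CG * (X * sqnorm v).
  apply: le_trans (G_le _ _ _) _; rewrite ler_wpM2l // mulrC.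
  by rewrite ler_wpM2r ?sqnorm_ge0.
have hb : b ^+ 2 <= CG * (X * sqnorm v).
  apply: le_trans (G_le _ _ _) _; rewrite ler_wpM2l //.
  by rewrite ler_wpM2r ?sqnorm_ge0.
rewrite expr_div_n [leRHS]mulrAC ler_pM2r ?invr_gt0 ?exprn_gt0 //.
have := sqr_ge0 (a - b); rewrite !expr2; rewrite !expr2 in ha hb; lra.
Qed.

(** The bound [d] on the mass of the plan off the graph of [s], the weight [mu]
    and the regularization [eps] enter only through these two conditions. *)
Theorem local_stability :
  4 * CG * X * d * (4 * CS) <= mu * eps ^+ 2 ->
  8 * ((1 + 2 * CS) * CS * CM * X) * (mu * d) <= 1 ->
  locally_asymptotically_stable step ze.
Proof.
move=> h1 h2.
pose pmin := \big[Num.min/1]_(ij : 'I_N * 'I_N) p ij.1 ij.2.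
have pmin0 : 0 < pmin by apply: lt_bigmin => // ij _; exact: eq_plan_gt0.
have pmin_le i j : pmin <= p i j by exact: (bigmin_le_cond _ _ (j := (i, j))).
have CS0 : 0 < CS by rewrite (lt_le_trans ltr01).
pose k := Num.min (4 * CS)^-1 (pmin / 2).
have k0 : 0 < k by rewrite lt_min invr_gt0 mulr_gt0 // divr_gt0.
have k1 : k <= 1.
  rewrite /k ge_min; apply/orP; left; rewrite invf_le1 ?mulr_gt0 //.
  by rewrite (le_trans CS1) // ler_peMl ?(ltW CS0) // ler1n.
have L0 : 0 <= 4 * CG * X / eps ^+ 2.
  by rewrite divr_ge0 ?sqr_ge0 // !mulr_ge0.
have hL : d * (4 * CG * X / eps ^+ 2) * (4 * CS) <= mu.
  have -> : d * (4 * CG * X / eps ^+ 2) * (4 * CS) =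
      4 * CG * X * d * (4 * CS) / eps ^+ 2 by ring.
  by rewrite ler_pdivrMr ?exprn_gt0.
have decr z : mu * (\sum_i bf (S i) (next_lin_x i z) (next_lin_x i z)) +
    \sum_j next_lin_theta j z ^+ 2 <= (1 - k) * lyap z.
  have := linear_decrease (fun i j => ltW (eq_plan_gt0 i j))
    eq_plan_row eq_plan_col
    S_ge S_le S_step M_le xd_le gibbs_lin_spread off_le CS1 CM0 X0 L0 d0 mu_gt0
    (dev_x^~ z) (dev_theta^~ z) hL h2.
  rewrite -/(next_lin_x _ z) => /le_trans; apply.
  rewrite mulrBl mul1r /lyap.
  set Q := \sum_i bf _ _ _; set T := \sum_j _; set X2 := \sum_i sqnorm _.
  set E := \sum_i wvar _ _.
  have QX : Q <= CS * X2 by rewrite mulr_sumr; apply: ler_sum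
    => i _; exact: S_le.
  have T0 : 0 <= T by apply: sumr_ge0 => j _; exact: sqr_ge0.
  have Q0 : 0 <= Q by apply: sumr_ge0 => j _; exact: S_ge0.
  have TE : pmin * T <= E.
    rewrite /E (bigD1 (Ordinal N_gt0)) //=.
    apply: (@le_trans _ _ (wvar (p (Ordinal N_gt0)) (dev_theta^~ z))).
      apply: wvar_lower_bound => //; first exact: ltW.
      exact: sum_cone_coord.
    rewrite lerDl; apply: sumr_ge0 => i _; apply: wvar_ge0 => j.
    exact: ltW (eq_plan_gt0 i j).
  have kT : k * T <= E / 2.
    apply: (@le_trans _ _ (pmin / 2 * T)).
      by rewrite ler_wpM2r // ge_min lexx orbT.
    lra.
  have kQ : k * (mu * Q) <= mu / 4 * X2.
    apply: (@le_trans _ _ ((4 * CS)^-1 * (mu * Q))).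
      by rewrite ler_wpM2r ?ge_min ?lexx // mulr_ge0 // ltW.
    rewrite mulrC ler_pdivrMr ?mulr_gt0 //.
    have : mu * Q <= mu * (CS * X2) by rewrite ler_wpM2l // ltW.
    lra.
  rewrite [k * _]mulrDr; lra.
(* [1 - k] is the rate of the linearization. *)
have near_step := lyap_step_near k0 decr.
apply: (@lyapunov_stability _ _ _ _ lyap (1 - k / 2)) => //.
- exact: lyap_ge0.
- by apply/andP; split; lra.
- exact: lyap_basis.
- exact: lyap_near.
Qed.

End Decrease.
End LyapunovFunction.
End LocalStability.

(** * Large and small regularization *)

Section FiniteBounds.
Variables (R : realType) (N : nat).

(** Finitely many upper bounds have a common one. *)
Lemma uniform_bound (P : 'I_N -> R -> Prop) : (0 < N)%N ->
  (forall i c c', c <= c' -> P i c -> P i c') ->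
  (forall i, {C : R | 1 <= C & P i C}) -> exists2 C, 1 <= C & forall i, P i C.
Proof.
move=> N0 mono h; pose c i := s2val (h i).
have c1 i : 1 <= c i by rewrite /c; case: (h i).
have cle i : c i <= \sum_j c j.
  rewrite (bigD1 i) //= lerDl sumr_ge0 // => j _.
  exact: le_trans ler01 (c1 j).
exists (\sum_j c j); first exact: le_trans (c1 (Ordinal N0)) (cle _).
by move=> i; apply: mono (cle i) _; rewrite /c; case: (h i).
Qed.

End FiniteBounds.

Lemma expRN_le_cube (R : realType) (u : R) : 0 < u -> expR (- u) <= 27 / u ^+ 3.
Proof.
move=> u0; pose v := u / 3.
have v0 : 0 < v by rewrite divr_gt0.
have -> : 27 / u ^+ 3 = (v ^+ 3)^-1 by rewrite /v; field; rewrite gt_eqF.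
rewrite expRN lef_pV2 ?posrE ?exprn_gt0 ?expR_gt0 //.
have -> : expR u = expR v ^+ 3 by rewrite -expRM_natl /v; congr expR; field.
by rewrite ler_pXn2r ?nnegrE ?expR_ge0 ?(ltW v0) // (le_trans _
  (expR_ge1Dx _)) // lerDr.
Qed.

Theorem theorem2 (R : realType) (N n m tau : nat)
    (hN : (0 < N)%N) (hn : (0 < n)%N) (hm : (0 < m)%N) (htau : (0 < tau)%N)
    (A : 'I_N -> 'M[R]_n) (B : 'I_N -> 'M[R]_(n, m)) (xd : 'I_N -> 'cV[R]_n)
    (hG : forall i, reach_gramian tau A B i \in unitmx)
    (hu : forall i j, exists u : 'cV[R]_m, A i *m xd j + B i *m u = xd j)
    (hA : forall i, A i \in unitmx)
    (z : R -> state R n N)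
    (hz : equilibrium_family tau A B xd z)
    (hiso : exists2 eps' : R, 0 < eps' &
       isolated_equilibrium (closed_loop tau A B xd eps') (z eps')) :
  (\forall eps \near +oo_R,
     locally_asymptotically_stable (closed_loop tau A B xd eps) (z eps))
  /\
  ((forall i j, i != j -> xd i != xd j) ->
   (exists s : 'S_N, Exp tau A B xd s z) ->
   \forall eps \near (0 : R)^'+,
     locally_asymptotically_stable (closed_loop tau A B xd eps) (z eps)).
Proof.
case: tau htau hG hz hiso => [//|t] _ hG hz _.
have [S HS] := choice (fun i => Abar_lyapunov (hG i) (hA i)).
have S_ge i := (HS i).1; have S_step i := (HS i).2.
have [CS CS1 S_le] : exists2 C, 1 <= C &
    forall i v, bf (S i) v v <= C * sqnorm v.
  apply: (uniform_bound hN) => [i c c' cc' h v|i]; last exact: bf_bound1.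
  by apply: le_trans (h v) _; rewrite ler_wpM2r ?sqnorm_ge0.
have [CM CM1 M_le] : exists2 C, 1 <= C &
    forall i v, sqnorm ((1%:M - Abar t.+1 A B i) *m v) <= C * sqnorm v.
  apply: (uniform_bound hN) => [i c c' cc' h v|i]; last exact: sqnorm_mul_bound.
  by apply: le_trans (h v) _; rewrite ler_wpM2r ?sqnorm_ge0.
have [CG CG1 G_le] : exists2 C, 1 <= C & forall i u v,
    bf (calG t.+1 A B i) u v ^+ 2 <= C * (sqnorm u * sqnorm v).
  apply: (uniform_bound hN) => [i c c' cc' h u v|i]; last exact: bf_bound.
  by apply: le_trans (h u v) _; rewrite ler_wpM2r ?mulr_ge0 ?sqnorm_ge0.
have [X X1 xd_le] : exists2 X, 1 <= X & forall i j, sqnorm (xd i - xd j) <= X.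
  exists (1 + \sum_i \sum_j sqnorm (xd i - xd j)).
    rewrite lerDl; apply: sumr_ge0 => i _; apply: sumr_ge0 => j _.
    exact: sqnorm_ge0.
  move=> i j; rewrite (bigD1 i) //= (bigD1 j) //= addrCA -addrA lerDl.
  rewrite !addr_ge0 // ?sumr_ge0 // => k _; first exact: sqnorm_ge0.
  by apply: sumr_ge0 => l _; exact: sqnorm_ge0.
have [CS0 CM0 CG0 X0] : [/\ 0 < CS, 0 < CM, 0 < CG & 0 < X].
  by split; apply: lt_le_trans ltr01 _.
set C3 := (1 + 2 * CS) * CS * CM * X.
have C30 : 0 < C3 by rewrite !mulr_gt0 // addr_gt0 // mulr_gt0.
have stable eps mu s d : 0 < eps -> 0 < mu -> 0 <= d ->
    (forall i, 1 - eq_plan t A B xd eps (z eps) i (s i) <= d) ->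
    4 * CG * X * d * (4 * CS) <= mu * eps ^+ 2 -> 8 * C3 * (mu * d) <= 1 ->
    locally_asymptotically_stable (closed_loop t.+1 A B xd eps) (z eps).
  move=> e0 mu0 d0 off h1 h2.
  exact: (local_stability hN hG e0 (hz _ e0) S_ge mu0 S_le S_step M_le xd_le
    G_le off CS1 (ltW CM0) (ltW CG0) (ltW X0) d0 h1 h2).
split.
  (* No concentration of the plan is available: [d = 1], and the second
     condition is met by a small weight [mu]. *)
  pose mu := (8 * C3)^-1.
  have mu0 : 0 < mu by rewrite invr_gt0 mulr_gt0.
  pose K := 4 * CG * X * 1 * (4 * CS) / mu.
  have K0 : 0 < K by rewrite divr_gt0 // !mulr_gt0.
  have : \forall eps \near +oo_R, 1 + K < eps.
    by apply: nbhs_pinfty_gt; rewrite num_real.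
  apply: filterS => eps Keps.
  have e1 : 1 <= eps by lra.
  have e0 : 0 < eps by lra.
  apply: (stable eps mu id 1) => //.
  - move=> i; rewrite lerBlDr lerDl ltW //; exact: eq_plan_gt0.
  - have : K <= eps ^+ 2.
      by apply: (@le_trans _ _ eps); [lra|rewrite expr2 ler_peMl // ltW].
    by rewrite /K ler_pdivrMr // [leRHS]mulrC.
  - by rewrite mulr1 mulfV // gt_eqF // mulr_gt0.
move=> _ [s [_ _ [b b0 /eqO_exP[k k0 hk]]]].
(* With [mu = 1] and [d = K * eps ^+ 3], both conditions hold for small [eps];
   the first one needs [d] to be negligible against [eps ^+ 2]. *)
pose K := N%:R * (k * (27 / b ^+ 3)).
have K0 : 0 < K by rewrite !mulr_gt0 ?ltr0n // invr_gt0 exprn_gt0.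
pose e0 := (1 + 4 * CG * X * K * (4 * CS) + 8 * C3 * K)^-1.
have P1 : 0 < 4 * CG * X * K * (4 * CS).
  by apply: mulr_gt0; last exact: mulr_gt0; apply: mulr_gt0 =>
    //; rewrite !mulr_gt0.
have P2 : 0 < 8 * C3 * K by rewrite mulr_gt0 // mulr_gt0.
have e00 : 0 < e0 by rewrite invr_gt0; lra.
near=> eps.
have eps0 : 0 < eps by near: eps; exact: nbhs_right_gt.
have epse : eps < e0 by near: eps; exact: nbhs_right_lt.
have dist : `|entropic_plan t.+1 A B xd eps (z eps).1 - perm_plan R s| <=
    k * `|expR (- b / eps)| by near: eps.
have off i : 1 - eq_plan t A B xd eps (z eps) i (s i) <= K * eps ^+ 3.
  have N0 : N%:R != 0 :> R by rewrite pnatr_eq0 -lt0n.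
  have be_pos' : pos_cone (\val (repr (z eps).2)) by move=> j; exact: pos_coneP.
  have := entropic_plan_softmax hN eps0 be_pos'
    (equilibrium_col hN (hz _ eps0)).
  move=> planE'.
  have -> : 1 - eq_plan t A B xd eps (z eps) i (s i) =
      - (N%:R * (entropic_plan t.+1 A B xd eps (z eps).1 -
        perm_plan R s) i (s i)).
    have -> : (entropic_plan t.+1 A B xd eps (z eps).1 - perm_plan R s) i (s i)
        = entropic_plan t.+1 A B xd eps (z eps).1 i (s i) - N%:R^-1.
      by rewrite mxE; congr (_ + _); rewrite mxE mxE eqxx.
    rewrite planE' planE // mulrBr mulrA divff // mul1r.
    by rewrite opprB.
  set D := _ - perm_plan R s in dist *.
  have entry : `|D i (s i)| <= `|D|.
    rewrite [leRHS]/Num.norm /= mx_normrE; apply/bigmax_geP; right.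
    by exists (i, s i).
  rewrite -mulrN (le_trans (ler_wpM2l _ (ler_norm _))) // normrN.
  rewrite /K -mulrA ler_wpM2l // (le_trans entry) // (le_trans dist) //.
  rewrite -mulrA ler_wpM2l ?(ltW k0) // ger0_norm ?expR_ge0 // mulNr.
  apply: le_trans (expRN_le_cube (divr_gt0 b0 eps0)) _.
  by rewrite expr_div_n invf_div mulrA mulrAC.
have epsE : eps * (1 + 4 * CG * X * K * (4 * CS) + 8 * C3 * K) < 1.
  by rewrite -ltr_pdivlMr ?div1r // -invr_gt0.
have Q1 : 0 < eps * (4 * CG * X * K * (4 * CS)) by rewrite mulr_gt0.
have Q2 : 0 < eps * (8 * C3 * K) by rewrite mulr_gt0.
have eps1 : eps <= 1 by lra.
apply: (stable eps 1 s (K * eps ^+ 3)) => //.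
- by rewrite mulr_ge0 // ?exprn_ge0 ?ltW.
- have -> : 4 * CG * X * (K * eps ^+ 3) * (4 * CS) =
    eps * (4 * CG * X * K * (4 * CS)) * eps ^+ 2 by ring.
  by rewrite ler_wpM2r ?sqr_ge0 //; lra.
- have -> : 8 * C3 * (1 * (K * eps ^+ 3)) = eps * (8 * C3 * K)
  * eps ^+ 2 by ring.
  rewrite mulr_ile1 ?sqr_ge0 ?exprn_ile1 ?ltW //; lra.
Unshelve. all: by end_near.
Qed.
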